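(* Let $n \ge 1$ be an integer, let $\sigma > 0$, and let $X_1,\dots,X_n$ be independent and identically distributed real random variables with mean zero that are $\sigma^2$-sub-Gaussian, i.e. $\mathbf{E}\exp(\lambda X_i) \le \exp\left(\frac{\lambda^2\sigma^2}{2}\right)$ for all $\lambda \in \mathbb{R}$ and all $i \in \{1,\dots,n\}$. Let $X = (X_1,\dots,X_n)^{\mathsf{T}}$ and let $M = (m_{ij}) \in \mathbb{R}^{n\times n}$ be a matrix. Set $c_1 = 2$ and $c_2 = 1$ if $M$ is diagonal-free (that is, $m_{ii} = 0$ for all $i$), and $c_1 = 20$ and $c_2 = 4$ otherwise. Then for every $\lambda \in \left[0, \frac{1}{3 c_2 \|M\|_{\mathsf{op}}\sigma^2}\right)$, $$\mathbf{E}\exp\left(\lambda\left[X^{\mathsf{T}} M X - \mathbf{E}[X^{\mathsf{T}} M X]\right]\right) \le \exp\left(c_1\lambda^2\sigma^4\|M\|_F^2\right).$$ Consequently, for every $t \ge 0$, $$\mathbf{P}\left(\left|X^{\mathsf{T}} M X - \mathbf{E}[X^{\mathsf{T}} M X]\right| \ge t\right) \le 2\exp\left(-\left(\frac{t^2}{4c_1\sigma^4\|M\|_F^2} \wedge \frac{t}{6c_2\sigma^2\|M\|_{\mathsf{op}}}\right)\right).$$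
   Context: $\|M\|_F = \left(\sum_{i,j} m_{ij}^2\right)^{1/2}$ is the Frobenius norm and $\|M\|_{\mathsf{op}}$ is the operator (spectral) norm of $M$ with respect to the Euclidean norm. $a \wedge b = \min(a,b)$. $M$ is not assumed to be symmetric. If $M = 0$, the quotients are read with the conventions $a/0 = +\infty$ for $a > 0$, $0/0 = 0$, and $\exp(-\infty)=0$. *)

(* Defs.v *)
From HB Require Import structures.
From mathcomp Require Import all_boot all_order all_algebra.
From mathcomp Require Import all_classical all_reals all_analysis.
Set Implicit Arguments.
Unset Strict Implicit.
Unset Printing Implicit Defensive.
Import Order.TTheory GRing.Theory Num.Theory.
Import numFieldNormedType.Exports.
Local Open Scope classical_set_scope.
Local Open Scope ring_scope.

Definition mutually_independent d (T : measurableType d) (R : realType)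
    (P : probability T R) (I : finType) (X : I -> {RV P >-> R}) : Prop :=
  forall (J : {set I}) (A : I -> set R), (forall i, measurable (A i)) ->
    P (\bigcap_(i in [set i | i \in J]) (X i @^-1` A i)) =
    (\prod_(i in J) P (X i @^-1` A i))%E.

(* The laws are compared on measurable sets only: the values of a measure
   outside the sigma-algebra are unconstrained. *)
Definition identically_distributed d (T : measurableType d) (R : realType)
    (P : probability T R) (I : finType) (X : I -> {RV P >-> R}) : Prop :=
  forall (i j : I) (A : set R), measurable A ->
    distribution P (X i) A = distribution P (X j) A.

(* [sigma2] is the variance proxy; 'M_P X l is E[exp(l X)] in \bar R, so the
   bound includes finiteness of all the exponential moments. *)
Definition sub_gaussian d (T : measurableType d) (R : realType)
    (P : probability T R) (X : {RV P >-> R}) (sigma2 : R) : Prop :=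
  forall l : R, ('M_P X l <= (expR (l ^+ 2 * sigma2 / 2))%:E)%E.

(* The library's norm on matrices is the sup norm, hence the following norms. *)
Definition frobenius_norm (R : realType) (m n : nat) (M : 'M[R]_(m, n)) : R :=
  Num.sqrt (\sum_i \sum_j M i j ^+ 2).

Definition euclidean_norm (R : realType) (n : nat) (x : 'cV[R]_n) : R :=
  Num.sqrt (\sum_i x i 0 ^+ 2).

Definition operator_norm (R : realType) (m n : nat) (M : 'M[R]_(m, n)) : R :=
  sup [set euclidean_norm (M *m x) |
        x in [set x : 'cV[R]_n | euclidean_norm x <= 1]].

Definition diagonal_free (R : realType) (n : nat) (M : 'M[R]_n) : bool :=
  [forall i, M i i == 0].

Definition quadratic_form (R : realType) (n : nat) (M : 'M[R]_n)
    (x : 'cV[R]_n) : R :=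
  (x^T *m M *m x) 0 0.

Definition random_vector d (T : measurableType d) (R : realType)
    (P : probability T R) (n : nat) (X : 'I_n -> {RV P >-> R}) (w : T) :
    'cV[R]_n :=
  \col_i X i w.

(* Main.v *)
(* Without decoupling: eliminate the variables one at a time.  By the Gaussian
   linearization exp(a x^2) = E_g exp(sqrt(2a) g x), a sub-Gaussian X satisfies
   the same bound on E exp(a X^2 + b X), a >= 0, as a Gaussian variable.
   Integrating out X_0 replaces the matrix S in
   E exp((|X|^2 - X^T S X) / (2 sigma^2)) by its Schur complement, whose
   diagonal still is at most 1, so that a >= 0 at every step; hence this expectation
   is at most (det S)^(-1/2).
   If M is diagonal-free, take S = I - B with B = lambda sigma^2 (M + M^T):
   B has trace 0 and spectrum in [-2/3, 2/3], and - ln (1 - r) <= r + r^2 there,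
   so that (det (I - B))^(-1/2) <= exp(|B|_F^2 / 2).
   In general, split M into its diagonal and its off-diagonal part and combine
   the two bounds at 2 lambda by x y <= (x^2 + y^2) / 2.
   The bound holds on the closed range of lambda, so Chernoff's method gives the
   tail bound directly, with lambda = min(t / (2 c1 sigma^4 |M|_F^2),
   1 / (3 c2 sigma^2 |M|_op)). *)
Require Import Defs.
From HB Require Import structures.
From mathcomp Require Import all_boot all_order all_algebra.
From mathcomp Require Import all_classical all_reals all_analysis.
From mathcomp Require Import complex measurable_realfun ring lra.
Set Implicit Arguments.
Unset Strict Implicit.
Unset Printing Implicit Defensive.
Import Order.TTheory GRing.Theory Num.Theory.
Import numFieldNormedType.Exports.
Local Open Scope classical_set_scope.
Local Open Scope ring_scope.

(** * Integrating out one of several independent variables *)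

(** The sets are carried over to [I] along [f], with the whole space outside its image, and
    independence is applied to the image of [K]. *)
Lemma mutually_independent_comp d (T : measurableType d) (R : realType)
    (P : probability T R) (I J : finType) (X : I -> {RV P >-> R}) (f : J -> I) :
  injective f -> mutually_independent X -> mutually_independent (X \o f).
Proof.
move=> f_inj indX K A mA.
pose B i := if [pick j | f j == i] is Some j then A j else setT.
have BfE j : B (f j) = A j.
  rewrite /B; case: pickP => [k /eqP/f_inj -> //|/(_ j)]; by rewrite eqxx.
have mB i : measurable (B i) by rewrite /B; case: pickP.
have := indX [set f j | j in K]%SET B mB.
rewrite big_imset /=; last by move=> ? ? _ _ /f_inj.
under [in X in _ = X -> _]eq_bigr do rewrite BfE.
move=> <-; congr (P _); apply/seteqP; split => w Kw.
  by move=> _ /imsetP[j jK ->]; rewrite BfE; exact: Kw.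
by move=> j jK; have := Kw (f j); rewrite /= BfE; apply; exact: imset_f.
Qed.

Section independent_head.
Local Open Scope ereal_scope.
Context d (T : measurableType d) (R : realType) (P : probability T R).
Variables (n : nat) (X : 'I_n.+1 -> {RV P >-> R}).
Hypothesis X_indep : mutually_independent X.

Let tail (w : T) : n.-tuple R := [tuple X (lift ord0 i) w | i < n].

Let measurable_tail : measurable_fun setT tail.
Proof.
apply/measurable_fun_tnthP => i; rewrite (_ : _ \o _ = X (lift ord0 i)) //.
by apply/funext => w /=; rewrite tnth_mktuple.
Qed.

HB.instance Definition _ := isMeasurableFun.Build _ _ _ _ tail measurable_tail.

Let pair (w : T) : R * n.-tuple R := (X ord0 w, tail w).

Let measurable_pair : measurable_fun setT pair.
Proof. exact: measurable_fun_pair. Qed.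

HB.instance Definition _ := isMeasurableFun.Build _ _ _ _ pair measurable_pair.

Let box (B : set R) (A : 'I_n -> set R) : set (R * n.-tuple R) :=
  B `*` [set t | forall i, A i (tnth t i)].

Let boxes : set (set (R * n.-tuple R)) :=
  [set C | exists2 B, measurable B &
     exists2 A, (forall i, measurable (A i)) & C = box B A].

Let measurable_cyl (A : 'I_n -> set R) : (forall i, measurable (A i)) ->
  measurable [set t : n.-tuple R | forall i, A i (tnth t i)].
Proof.
move=> mA.
rewrite (_ : [set _ | _] = \bigcap_(i in setT) (@tnth n R ^~ i @^-1` A i)).
  apply: fin_bigcap_measurable => // i _; rewrite -[X in measurable X]setTI.
  exact: measurable_tnth.
by apply/seteqP; split => t /= At i; [move=> _|]; exact: At.
Qed.

(** The identity map out of the sigma-algebra generated by the boxes is measurable, because each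
    coordinate cylinder is a box whose other sides are full. *)
Let measurable_boxes : measurable = <<s boxes >>.
Proof.
apply/seteqP; split; last first.
  apply: smallest_sub; first exact: sigma_algebra_measurable.
  by move=> _ [B mB [A mA ->]]; apply: measurableX => //; exact: measurable_cyl.
pose S := g_sigma_algebraType boxes.
suff mid : measurable_fun setT (id : S -> R * n.-tuple R).
  by move=> C mC; have := mid measurableT C mC; rewrite setTI preimage_id.
apply/measurable_fun_pairP; split.
  move=> _ B mB; rewrite setTI; apply: sub_sigma_algebra.
  exists B => //; exists (fun=> setT) => //.
  by apply/seteqP; split => [[x t] //|[x t] [] //].
apply/measurable_fun_tnthP => i _ B mB; rewrite setTI; apply: sub_sigma_algebra.
exists setT => //; exists (fun j => if j == i then B else setT).
  by move=> j; case: ifP.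
apply/seteqP; split => -[x t] /=.
  by move=> Bt; split => // j; case: eqP => // ->.
by case=> _ /(_ i); rewrite eqxx.
Qed.

(** Boxes are stable under intersection and generate the sigma-algebra, so two finite measures that
    agree on them are equal. On a box, independence is applied to all the indices and to all but the
    first; dividing the index set this way isolates the factor of [X ord0]. *)
Let joint_law C : measurable C ->
  (distribution P (X ord0) \x distribution P tail) C = distribution P pair C.
Proof.
apply: (measure_unique boxes (fun=> setT)) => //.
- move=> _ _ [B1 mB1 [A1 mA1 ->]] [B2 mB2 [A2 mA2 ->]].
  exists (B1 `&` B2); first exact: measurableI.
  exists (fun i => A1 i `&` A2 i); first by move=> i; exact: measurableI.
  rewrite /box -setXI; congr (_ `*` _).
  apply/seteqP; split => t /=; first by move=> [h1 h2] i; split.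
  by move=> h; split => i; have [] := h i.
- move=> _; exists setT => //; exists (fun=> setT) => //.
  by apply/seteqP; split => // -[x t].
- by rewrite bigcup_const.
- move=> _ [B mB [A mA ->]].
  rewrite /box /= product_measure1E //; last exact: measurable_cyl.
  pose A' i := if unlift ord0 i is Some j then A j else B.
  have A'0 : A' ord0 = B by rewrite /A' unlift_none.
  have A'l j : A' (lift ord0 j) = A j by rewrite /A' liftK.
  have mA' i : measurable (A' i) by rewrite /A'; case: unliftP.
  have := X_indep [set: 'I_n.+1]%SET mA'.
  have := X_indep (~: [set ord0])%SET mA'.
  rewrite big_mkcond big_ord_recl /= !inE eqxx mul1e.
  under eq_bigr do rewrite !inE /= A'l.
  rewrite /distribution /pushforward => tailE.
  rewrite (eq_bigl xpredT); last by move=> i; rewrite inE.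
  rewrite big_ord_recl /= A'0; under eq_bigr do rewrite A'l.
  rewrite -tailE => pairE.
  rewrite [X in _ = P X](_ : _ =
    \bigcap_(i in [set` [set: 'I_n.+1]%SET]) X i @^-1` A' i); last first.
    apply/seteqP; split => w /=.
      move=> [Bw Aw] i _ /=; case: (unliftP ord0 i) => [j ->|->]; last by rewrite A'0.
      by rewrite A'l; have := Aw j; rewrite tnth_mktuple.
    move=> Aw; split; first by have := Aw ord0; rewrite A'0; apply; rewrite /= inE.
    move=> j /=; rewrite tnth_mktuple -A'l; apply: Aw; by rewrite /= inE.
  rewrite pairE; congr (_ * P _); apply/seteqP; split => w /=.
    move=> Aw i /=; rewrite !inE; case: (unliftP ord0 i) => [j -> _|->]; last by rewrite eqxx.
    by rewrite A'l; have := Aw j; rewrite tnth_mktuple.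
  move=> Aw j /=; rewrite tnth_mktuple -A'l; apply: Aw.
  by rewrite /= !inE.
- move=> _; rewrite -setXTT /= product_measure1E //.
  by rewrite -ge0_fin_numE ?mule_ge0 // fin_numM // fin_num_measure.
Qed.

(** Conditioning on the tail, by Tonelli for the product law: [X ord0] is integrated out with the
    other variables frozen. An inequality is what the induction steps need, since they only bound
    the inner integral. *)
Lemma ge0_le_integral_independent_head (F : R * n.-tuple R -> \bar R)
    (G : n.-tuple R -> \bar R) :
  measurable_fun setT F -> (forall z, 0 <= F z) ->
  measurable_fun setT G ->
  (forall t, \int[P]_w F (X ord0 w, t) <= G t) ->
  \int[P]_w F (X ord0 w, [tuple X (lift ord0 i) w | i < n]) <=
  \int[P]_w G [tuple X (lift ord0 i) w | i < n].
Proof.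
move=> mF F0 mG FG.
have G0 t : 0 <= G t by apply: le_trans (FG t); exact: integral_ge0.
rewrite [leLHS](_ : _ = \int[distribution P pair]_z F z); last first.
  by rewrite ge0_integral_distribution.
rewrite [leLHS](_ : _ =
    \int[distribution P (X ord0) \x distribution P tail]_z F z); last first.
  by apply: eq_measure_integral => C mC _; exact: (esym (joint_law mC)).
rewrite fubini_tonelli2 //.
rewrite [leRHS](_ : _ = \int[distribution P tail]_t G t); last first.
  by rewrite ge0_integral_distribution.
apply: ge0_le_integral => //.
- by move=> t _; apply: integral_ge0.
- exact: measurable_fun_fubini_tonelli_G.
- move=> t _; rewrite /fubini_G ge0_integral_distribution //=.
  exact: measurableT_comp.
Qed.

End independent_head.

(** * One sub-Gaussian variable *)

(** Completing the square turns the integrand into a multiple of the normal density with mean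
    [b / p] and variance [1 / p]. *)
Lemma integral_normal_pdf_expR (R : realType) (p b : R) : 0 < p ->
  (\int[lebesgue_measure]_x
     (normal_pdf 0 1 x * expR ((1 - p) / 2 * x ^+ 2 + b * x))%:E =
   ((Num.sqrt p)^-1 * expR (b ^+ 2 / (2 * p)))%:E)%E.
Proof.
move=> p0; have p_neq0 : p != 0 by rewrite gt_eqF.
pose s := (Num.sqrt p)^-1; have s_neq0 : s != 0 by rewrite invr_eq0 sqrtr_eq0 -ltNge.
have s2 : s ^+ 2 = p^-1 by rewrite /s exprVn sqr_sqrtr // ltW.
have peak1 : normal_peak 1 = s * normal_peak s.
  rewrite /normal_peak s2 expr1n mul1r -mulrnAr sqrtrM ?invr_ge0 ?ltW //.
  by rewrite sqrtrV ?ltW // -/s invfM mulrA divff // mul1r.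
transitivity (\int[lebesgue_measure]_x
  ((s * expR (b ^+ 2 / (2 * p)))%:E * (normal_pdf (b / p) s x)%:E))%E.
  apply: eq_integral => x _; rewrite -EFinM; congr EFin.
  rewrite !normal_pdfE ?oner_eq0 // /normal_fun peak1 -!mulrA; congr (_ * _).
  rewrite [RHS]mulrCA; congr (_ * _); rewrite -!expRD; congr expR.
  by rewrite s2; field.
rewrite integralZl //; last exact: integrable_normal_pdf.
by rewrite integral_normal_pdf mule1.
Qed.

Lemma measurable_normal_pdf_expR (R : realType) (a b : R) :
  measurable_fun setT
    (fun x : R => (normal_pdf 0 1 x * expR (a * x ^+ 2 + b * x))%:E).
Proof.
apply/measurable_EFinP/measurable_funM; first exact: measurable_normal_pdf.
apply: measurableT_comp => //; apply: measurable_funD.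
  by apply: measurable_funM => //; exact: measurable_funX.
exact: measurable_funM.
Qed.

Section sub_gaussian_moments.
Local Open Scope ereal_scope.
Context d (T : measurableType d) (R : realType) (P : probability T R).
Variables (X : {RV P >-> R}) (s : R).
Hypotheses (s_gt0 : (0 < s)%R) (X_subg : sub_gaussian X s).

Lemma sub_gaussian_integral_expR (l : R) :
  \int[P]_w (expR (l * X w))%:E <= (expR (l ^+ 2 * s / 2))%:E.
Proof.
have := X_subg l; rewrite /mmt_gen_fun unlock; apply: le_trans.
by rewrite le_eqVlt; apply/orP; left; apply/eqP/eq_integral => w _ /=; rewrite mulrC.
Qed.

(** The right-hand side is the exact value for a centered Gaussian of variance [s]. The square is
    linearized by an auxiliary standard normal [g] with coefficient [k]; after Tonelli the
    sub-Gaussian bound applies at [k * g + b], and a Gaussian integral in [g] remains. *)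
Lemma sub_gaussian_integral_expR_sqr (p b : R) : (0 < p <= 1)%R ->
  \int[P]_w (expR ((1 - p) / (2 * s) * X w ^+ 2 + b * X w))%:E <=
  ((Num.sqrt p)^-1 * expR (s * b ^+ 2 / (2 * p)))%:E.
Proof.
move=> /andP[p0 p1].
have s_neq0 : (s != 0)%R by rewrite gt_eqF.
have p_neq0 : (p != 0)%R by rewrite gt_eqF.
pose k := Num.sqrt ((1 - p) / s).
have k2 : (k ^+ 2 = (1 - p) / s)%R by rewrite sqr_sqrtr // divr_ge0 ?subr_ge0 // ltW.
pose f (z : T * R) := (normal_pdf 0 1 z.2 * expR ((k * z.2 + b) * X z.1))%:E.
have f0 z : 0 <= f z by rewrite lee_fin mulr_ge0 ?normal_pdf_ge0 ?expR_ge0.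
have mf : measurable_fun setT f.
  apply/measurable_EFinP/measurable_funM.
    by apply: measurableT_comp => //; exact: measurable_normal_pdf.
  apply: measurableT_comp => //; apply: measurable_funM.
    by apply: measurable_funD => //; exact: measurable_funM.
  exact: measurableT_comp.
rewrite [leLHS](_ : _ = \int[P]_w \int[lebesgue_measure]_g f (w, g)); last first.
  apply: eq_integral => w _.
  (* The null coefficient [(1 - 1) / 2] presents the integral as the case [p = 1] of
     [integral_normal_pdf_expR]. *)
  transitivity (\int[lebesgue_measure]_g ((expR (b * X w))%:E *
    (normal_pdf 0 1 g * expR ((1 - 1) / 2 * g ^+ 2 + k * X w * g))%:E)).
    rewrite ge0_integralZl //=; first last.
    - by move=> g _; rewrite lee_fin mulr_ge0 ?normal_pdf_ge0 ?expR_ge0.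
    - exact: measurable_normal_pdf_expR.
    rewrite integral_normal_pdf_expR // sqrtr1 invr1 mul1r -EFinM -expRD.
    by rewrite exprMn k2; congr (expR _)%:E; field.
  apply: eq_integral => g _; rewrite /f -EFinM /= mulrCA -expRD.
  by congr (_ * expR _)%:E; ring.
rewrite fubini_tonelli //.
have le_f g : \int[P]_w f (w, g) <=
    (expR (s * b ^+ 2 / 2))%:E *
    (normal_pdf 0 1 g * expR ((1 - p) / 2 * g ^+ 2 + s * k * b * g))%:E.
  rewrite /f /=; under eq_integral do rewrite EFinM.
  rewrite ge0_integralZl //=; last by rewrite lee_fin normal_pdf_ge0.
  - rewrite -EFinM mulrCA EFinM lee_wpmul2l ?lee_fin ?normal_pdf_ge0 //.
    apply: (le_trans (sub_gaussian_integral_expR _)).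
    rewrite lee_fin -expRD ler_expR le_eqVlt; apply/orP; left; apply/eqP.
    rewrite sqrrD exprMn k2; by field.
  - by apply/measurable_EFinP/measurableT_comp => //; exact: measurable_funM.
apply: (@le_trans _ _ (\int[lebesgue_measure]_g ((expR (s * b ^+ 2 / 2))%:E *
    (normal_pdf 0 1 g * expR ((1 - p) / 2 * g ^+ 2 + s * k * b * g))%:E))).
  apply: ge0_le_integral => //=.
  - by move=> g _; apply: integral_ge0 => w _; exact: f0.
  - exact: measurable_fun_fubini_tonelli_G.
  - by apply: measurable_funeM; exact: measurable_normal_pdf_expR.
rewrite ge0_integralZl //=; first last.
- by move=> g _; rewrite lee_fin mulr_ge0 ?normal_pdf_ge0 ?expR_ge0.
- exact: measurable_normal_pdf_expR.
- rewrite integral_normal_pdf_expR // -EFinM lee_fin mulrCA -expRD.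
  rewrite !exprMn k2 le_eqVlt; apply/orP; left; apply/eqP; congr (_ * expR _)%R.
  by field; rewrite p_neq0.
Qed.

End sub_gaussian_moments.

Lemma expR_ge_series (R : realType) (x : R) n :
  0 <= x -> series (exp_coeff x) n <= expR x.
Proof.
move=> x0; apply: nondecreasing_cvgn_le; last exact: is_cvg_series_exp_coeff.
by apply: nondecreasing_series => i _ _; rewrite exp_coeff_ge0.
Qed.

(** Termwise in the power series: [t ^+ k <= t ^+ 2] for k at least 2, whatever the sign of [t]. It
    turns one exponential moment, that of [y], into a bound for all smaller multiples with an error
    quadratic in [t]. *)
Lemma expRM_le_quadratic (R : realType) (t y : R) : `|t| <= 1 -> 0 <= y ->
  expR (t * y) <= 1 + t * y + t ^+ 2 * (expR y - 1 - y).
Proof.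
move=> t1 y0.
have t2 : `|t| ^+ 2 = t ^+ 2 by rewrite real_normK ?num_real.
have partial n : series (exp_coeff (t * y)) n.+2 <=
    1 + t * y + t ^+ 2 * (series (exp_coeff y) n.+2 - 1 - y).
  rewrite /series /= !big_nat_recl // /exp_coeff /=.
  rewrite (_ : 0`! = 1%N) // (_ : 1`! = 1%N) // !expr0 !expr1 !divr1 !addrA.
  set S := \sum_(0 <= i < n) y ^+ _ / _.
  have -> : 1 + y + S - 1 - y = S by ring.
  rewrite lerD2l /S {S}.
  rewrite mulr_sumr; apply: ler_sum => i _.
  rewrite exprMn -mulrA ler_wpM2r ?divr_ge0 ?exprn_ge0 //.
  rewrite -t2; apply: (le_trans (ler_norm _)); rewrite normrX.
  by rewrite ler_wiXn2l.
rewrite {1}/expR; apply: limr_le; first exact: is_cvg_series_exp_coeff.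
near=> n.
rewrite -(@subnK 2 n); last by near: n; exists 2%N.
rewrite addn2; apply: (le_trans (partial _)).
by rewrite lerD2l ler_wpM2l ?sqr_ge0 // !lerD2r expR_ge_series.
Unshelve. all: by end_near.
Qed.

Section sub_gaussian_square.
Context d (T : measurableType d) (R : realType) (P : probability T R).
Variables (X : {RV P >-> R}) (s : R).
Hypotheses (s_gt0 : 0 < s) (X_subg : sub_gaussian X s).

(* Chosen so that [E exp (a X^2) <= (1 - 2 a s)^(-1/2) = 2]. *)
Let a : R := 3 / (8 * s).

Let a_gt0 : 0 < a. Proof. by rewrite divr_gt0 // mulr_gt0. Qed.

Let measurable_sqr : measurable_fun setT (fun w => X w ^+ 2).
Proof. exact: measurable_funX. Qed.

Let expR_sqr_le2 : (\int[P]_w (expR (a * X w ^+ 2))%:E <= 2%:E)%E.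
Proof.
(* With [p = 1 / 4], the coefficient [(1 - p) / (2 * s)] is [a]. *)
have p01 : 0 < (1 / 4 : R) <= 1 by lra.
have := sub_gaussian_integral_expR_sqr s_gt0 X_subg 0 p01.
have -> : (Num.sqrt (1 / 4))^-1 = 2 :> R.
  have -> : 1 / 4 = (1 / 2) ^+ 2 :> R by lra.
  by rewrite sqrtr_sqr ger0_norm ?divr_ge0 // div1r invrK.
rewrite expr0n /= mulr0 mul0r expR0 mulr1; apply: le_trans.
rewrite le_eqVlt; apply/orP; left; apply/eqP; apply: eq_integral => w _.
by congr (expR _)%:E; rewrite /a; field; rewrite gt_eqF.
Qed.

Let integrable_expR_sqr : P.-integrable setT (EFin \o (fun w => expR (a * X w ^+ 2))).
Proof.
apply/integrableP; split.
  by apply/measurable_EFinP; apply: measurableT_comp => //; exact: measurable_funM.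
under eq_integral do rewrite /= ger0_norm ?expR_ge0 //.
by apply: le_lt_trans expR_sqr_le2 _; rewrite ltry.
Qed.

Lemma sub_gaussian_integrable_sqr : P.-integrable setT (EFin \o (fun w => X w ^+ 2)).
Proof.
have int := integrableZl measurableT a^-1 integrable_expR_sqr.
apply: le_integrable int => //; first exact/measurable_EFinP.
move=> w _; rewrite lee_fin (ger0_norm (sqr_ge0 _)).
rewrite ger0_norm ?mulr_ge0 ?expR_ge0 ?invr_ge0 ?(ltW a_gt0) //.
rewrite mulrC ler_pdivlMr // mulrC.
by apply: le_trans (expR_ge1Dx _); rewrite lerDr.
Qed.

(** Apply [expRM_le_quadratic] with [y = a * X ^+ 2] and [t = u / a]. As E exp(y) is at most 2, the
    expectation of exp(u X^2) is at most 1 + u mu + t^2, and 1 + x <= exp x absorbs the centering.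
    Here t^2 = (64 / 9) u^2 s^2, rounded up to 10 u^2 s^2. *)
Lemma sub_gaussian_sqr_mgf_le (u mu : R) :
  (\int[P]_w (X w ^+ 2)%:E = mu%:E)%E -> 6 * s * `|u| <= 1 ->
  (\int[P]_w (expR (u * (X w ^+ 2 - mu)))%:E <= (expR (10 * u ^+ 2 * s ^+ 2))%:E)%E.
Proof.
move=> muE us.
have mu0 : 0 <= mu.
  by rewrite -lee_fin -muE; apply: integral_ge0 => w _; rewrite lee_fin sqr_ge0.
pose t := u / a.
have t1 : `|t| <= 1.
  rewrite normrM normfV (gtr0_norm a_gt0) ler_pdivrMr // mul1r /a ler_pdivlMr ?mulr_gt0 //.
  by have := normr_ge0 u; lra.
have t2 : t ^+ 2 <= 10 * u ^+ 2 * s ^+ 2.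
  have -> : t ^+ 2 = 64 / 9 * (u ^+ 2 * s ^+ 2) by rewrite /t /a; field; rewrite gt_eqF.
  by have := mulr_ge0 (sqr_ge0 u) (sqr_ge0 s); lra.
(* Regrouping the quadratic bound gives the coefficients [1 - t ^+ 2] of 1, [b] of X^2 and [t ^+ 2]
   of exp(a X^2). *)
pose b := u - t ^+ 2 * a.
have step : (\int[P]_w (expR (u * X w ^+ 2))%:E <=
    (1 + u * mu + 10 * u ^+ 2 * s ^+ 2)%:E)%E.
  have intX := sub_gaussian_integrable_sqr.
  pose f0 : T -> \bar R := EFin \o cst (1 - t ^+ 2).
  pose f1 : T -> \bar R := EFin \o (fun w => X w ^+ 2).
  pose f2 : T -> \bar R := EFin \o (fun w => expR (a * X w ^+ 2)).
  have int0 : P.-integrable setT f0.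
    exact: finite_measure_integrable_cst.
  have int1 := integrableZl measurableT b intX.
  have int2 := integrableZl measurableT (t ^+ 2) integrable_expR_sqr.
  have int12 := integrableD measurableT int1 int2.
  apply: (@le_trans _ _ (\int[P]_w (f0 w + (b%:E * f1 w + (t ^+ 2)%:E * f2 w)))%E).
    apply: ge0_le_integral => //.
    - by apply/measurable_EFinP; apply: measurableT_comp => //; exact: measurable_funM.
    - exact: (measurable_int _ (integrableD measurableT int0 int12)).
    - move=> w _; rewrite -!EFinM -!EFinD lee_fin.
      have aX0 : 0 <= a * X w ^+ 2 by rewrite mulr_ge0 ?sqr_ge0 ?(ltW a_gt0).
      have := expRM_le_quadratic t1 aX0.
      have -> : t * (a * X w ^+ 2) = u * X w ^+ 2.
        by rewrite mulrA /t divfK // gt_eqF.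
      move=> /le_trans; apply.
      by rewrite le_eqVlt; apply/orP; left; apply/eqP; rewrite /b /=; ring.
  rewrite integralD // integralD // !integralZl // muE.
  rewrite (_ : f0 = cst (1 - t ^+ 2)%:E) // integral_cst //= probability_setT mule1.
  apply: (@le_trans _ _ ((1 - t ^+ 2)%:E + (b%:E * mu%:E + (t ^+ 2)%:E * 2%:E))%E).
    by rewrite leeD2l // leeD2l // lee_wpmul2l ?lee_fin ?sqr_ge0.
  rewrite -!EFinM -!EFinD lee_fin /b.
  (* The remaining term [- t ^+ 2 * a * mu] is nonpositive and is dropped. *)
  have := mulr_ge0 (mulr_ge0 (sqr_ge0 t) (ltW a_gt0)) mu0; lra.
under eq_integral do rewrite mulrBr expRD mulrC EFinM.
rewrite ge0_integralZl //=; last first.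
- by apply/measurable_EFinP; apply: measurableT_comp => //; exact: measurable_funM.
apply: (@le_trans _ _ ((expR (- (u * mu)))%:E * (expR (u * mu + 10 * u ^+ 2 * s ^+ 2))%:E)%E).
  rewrite lee_wpmul2l ?lee_fin ?expR_ge0 //; apply: (le_trans step).
  by rewrite lee_fin -addrA expR_ge1Dx.
by rewrite -EFinM -expRD addKr.
Qed.

End sub_gaussian_square.

(** * Quadratic forms and Schur complements *)

Lemma quadratic_formE (R : realType) n (M : 'M[R]_n) (x : 'cV[R]_n) :
  quadratic_form M x = \sum_i \sum_j M i j * x i 0 * x j 0.
Proof.
rewrite /quadratic_form mxE exchange_big /=; apply: eq_bigr => j _.
rewrite mxE mulr_suml; apply: eq_bigr => i _.
by rewrite mxE [x i 0 * _]mulrC.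
Qed.

Section schur.
Context (R : realType) (n : nat) (S : 'M[R]_n.+1).
Hypotheses (S_sym : S^T = S) (S00_gt0 : 0 < S ord0 ord0).

Definition schur_complement : 'M[R]_n :=
  \matrix_(i, j) (S (lift ord0 i) (lift ord0 j) -
    S ord0 (lift ord0 i) * S ord0 (lift ord0 j) / S ord0 ord0).

Let p := S ord0 ord0.

Let SE i j : S i j = S j i. Proof. by rewrite -{1}S_sym mxE. Qed.

Lemma schur_complement_sym : schur_complement^T = schur_complement.
Proof.
apply/matrixP => i j; rewrite !mxE SE.
by rewrite [X in X / _]mulrC.
Qed.

(** Completing the square in the first coordinate. *)
Lemma quadratic_form_schur (x : 'cV[R]_n.+1) :
  let y : 'cV[R]_n := \col_i x (lift ord0 i) 0 in
  quadratic_form S x =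
  p * (x ord0 0 + (\sum_i S ord0 (lift ord0 i) * y i 0) / p) ^+ 2 +
  quadratic_form schur_complement y.
Proof.
move=> y; set b := \sum_i _.
have p_neq0 : p != 0 by rewrite gt_eqF.
have yE i : x (lift ord0 i) 0 = y i 0 by rewrite mxE.
rewrite !quadratic_formE big_ord_recl big_ord_recl /= -/p.
under [X in _ + X + _]eq_bigr do rewrite yE mulrAC -mulrA.
under [X in _ + X = _]eq_bigr => i _.
  rewrite big_ord_recl /= [S _ ord0]SE yE; under eq_bigr do rewrite yE; over.
rewrite big_split /= -mulr_suml -/b.
under [X in _ + X + _]eq_bigr do rewrite mulrA.
rewrite -mulr_suml -/b.
have -> : \sum_i \sum_j schur_complement i j * y i 0 * y j 0 =
    \sum_i \sum_j S (lift ord0 i) (lift ord0 j) * y i 0 * y j 0 - b ^+ 2 / p.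
  rewrite expr2 {1}/b !mulr_suml -sumrB; apply: eq_bigr => i _.
  rewrite mulrAC mulr_sumr -sumrB.
  by apply: eq_bigr => j _; rewrite mxE -/p; field.
by field.
Qed.

(** One step of Gaussian elimination: the unipotent [L] clears the first column below the pivot [p],
    and the lower right block becomes the Schur complement. *)
Lemma det_schur : \det S = p * \det schur_complement.
Proof.
have p_neq0 : p != 0 by rewrite gt_eqF.
pose A : 'M[R]_(1 + n) := S.
pose L := block_mx 1%:M 0 ((- p^-1) *: dlsubmx A) 1%:M.
have -> : (\det S = \det (L *m A)) by rewrite det_mulmx det_lblock !det1 !mul1r.
have ulA : ulsubmx A = p%:M.
  by apply/matrixP => i j; rewrite !ord1 !mxE eqxx /=; congr (S _ _); exact: val_inj.
rewrite -[A]submxK /L mulmx_block !mul1mx !mul0mx !addr0 ulA.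
rewrite mul_mx_scalar scalerA mulrN divff // scaleN1r addNr.
rewrite det_ublock det_scalar1 -scalemxAl; congr (_ * \det _).
apply/matrixP => i j; rewrite !mxE big_ord1 !mxE addrC.
have lE k : rshift 1 k = lift ord0 k :> 'I_n.+1 by exact/val_inj.
have l0 : lshift n (ord0 : 'I_1) = ord0 :> 'I_n.+1 by exact/val_inj.
by rewrite !lE l0 /A [S (lift _ _) ord0]SE; congr (_ + _); rewrite -/p; field.
Qed.

End schur.

Section quadratic_exponential_moment.
Local Open Scope ereal_scope.
Context d (T : measurableType d) (R : realType) (P : probability T R).

(** Induction on [n]: integrating out the first variable costs the factor p^(-1/2) of its pivot, and
    the pivots multiply to the determinant. Positivity of the determinant is carried along the same
    recursion. *)
Lemma det_posdef_gt0_sub_gaussian_expR_le (s : R) n (X : 'I_n -> {RV P >-> R})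
    (S : 'M[R]_n) :
  (0 < s)%R -> mutually_independent X -> (forall i, sub_gaussian (X i) s) ->
  S^T%R = S -> (forall x, x != 0 -> 0 < quadratic_form S x)%R ->
  (forall i, S i i <= 1)%R ->
  (0 < \det S)%R /\
  \int[P]_w (expR ((\sum_i X i w ^+ 2 - quadratic_form S (random_vector X w)) /
                   (2 * s)))%:E <= ((Num.sqrt (\det S))^-1)%:E.
Proof.
move=> s0; elim: n X S => [|n IH] X S indX subX symS posS diagS.
  rewrite det_mx00; split => //; under eq_integral => w _.
    rewrite big_ord0 quadratic_formE big_ord0 subr0 mul0r expR0; over.
  by rewrite integral_cst //= mul1e probability_setT sqrtr1 invr1.
set p := S ord0 ord0.
have qfS x := quadratic_form_schur symS _ x.
have p0 : (0 < p)%R.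
  (* The pivot is the value of the form at the first basis vector. *)
  have := posS (delta_mx ord0 0%R); rewrite quadratic_formE.
  rewrite big_ord_recl big_ord_recl /= !mxE !eqxx !mulr1 -/p.
  rewrite !big1 ?addr0; last 2 first.
  - by move=> i _; rewrite big1 // => j _; rewrite !mxE /= mulr0 mul0r.
  - by move=> i _; rewrite !mxE /= mulr0.
  apply; apply/eqP => /matrixP/(_ ord0 0%R)/eqP; by rewrite !mxE !eqxx oner_eq0.
have p_neq0 : (p != 0)%R by rewrite gt_eqF.
have s_neq0 : (s != 0)%R by rewrite gt_eqF.
set S' := schur_complement S.
have [|||||detS' leS'] := IH (fun i => X (lift ord0 i)) S'.
- exact: (mutually_independent_comp (@lift_inj _ ord0) indX).
- by move=> i; exact: subX.
- exact: schur_complement_sym.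
- move=> y y0.
  (* The first coordinate [- (c / p)] annihilates the completed square, so the form of [S] at [x]
     equals that of [S'] at [y]. *)
  pose c := (\sum_i S ord0 (lift ord0 i) * y i 0)%R.
  pose x : 'cV[R]_n.+1 :=
    (\col_i if unlift ord0 i is Some j then y j 0 else - (c / p))%R.
  have xy : (\col_i x (lift ord0 i) 0)%R = y.
    by apply/matrixP => i j; rewrite !mxE liftK ord1.
  have := posS x; rewrite qfS // xy -/c -/p mxE unlift_none addNr expr0n mulr0 add0r.
  apply; apply: contra_neq y0 => x0; rewrite -xy x0.
  by apply/matrixP => i j; rewrite !mxE.
- move=> i; rewrite mxE; apply: le_trans (diagS (lift ord0 i)).
  by rewrite gerBl -expr2 divr_ge0 ?sqr_ge0 // ltW.
have detS : (\det S = p * \det S')%R by exact: det_schur.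
split; first by rewrite detS mulr_gt0.
(* For a frozen tail [t], the exponent is [(1 - p) / (2 * s) * x ^+ 2 + b t * x + r t] in the first
   variable [x], and [q] is the exponent for [S']. Integrating out [x] yields
   [s * b t ^+ 2 / (2 * p)], exactly what [r] subtracts from [q]. *)
pose b (t : n.-tuple R) := (- (\sum_i S ord0 (lift ord0 i) * tnth t i) / s)%R.
pose q (t : n.-tuple R) := ((\sum_i tnth t i ^+ 2 -
  quadratic_form S' (\col_i tnth t i)) / (2 * s))%R.
pose r t := (q t - s * b t ^+ 2 / (2 * p))%R.
pose F (z : R * n.-tuple R) :=
  (expR ((1 - p) / (2 * s) * z.1 ^+ 2 + b z.2 * z.1 + r z.2))%:E.
pose G (t : n.-tuple R) := ((Num.sqrt p)^-1 * expR (q t))%:E.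
have mt i : measurable_fun setT (fun t : n.-tuple R => tnth t i).
  exact: measurable_tnth.
have mb : measurable_fun setT b.
  apply: measurable_funM => //; apply: measurableT_comp => //.
  by apply: measurable_sum => i; exact: measurable_funM.
have mq : measurable_fun setT q.
  apply: measurable_funM => //; apply: measurable_funB.
    by apply: measurable_sum => i; exact: measurable_funX.
  under eq_fun do rewrite quadratic_formE.
  apply: measurable_sum => i; apply: measurable_sum => j.
  by under eq_fun do rewrite !mxE; do 2! apply: measurable_funM => //.
have mG : measurable_fun setT G.
  apply/measurable_EFinP; apply: measurable_funM => //.
  exact: measurableT_comp.
have mr : measurable_fun setT r.
  apply: measurable_funB => //; do 2! apply: measurable_funM => //.
  exact: measurable_funX.
have mF : measurable_fun setT F.
  apply/measurable_EFinP; apply: measurableT_comp => //.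
  apply: measurable_funD; last exact: measurableT_comp.
  apply: measurable_funD; first by apply: measurable_funM => //; exact: measurable_funX.
  by apply: measurable_funM => //; exact: measurableT_comp.
have FG t : \int[P]_w F (X ord0 w, t) <= G t.
  rewrite /F /=; under eq_integral do rewrite expRD mulrC EFinM.
  rewrite ge0_integralZl //=.
  - apply: (@le_trans _ _ ((expR (r t))%:E *
        ((Num.sqrt p)^-1 * expR (s * b t ^+ 2 / (2 * p)))%:E)).
      rewrite lee_wpmul2l ?lee_fin ?expR_ge0 //.
      by apply: sub_gaussian_integral_expR_sqr => //; rewrite p0 diagS.
    by rewrite -EFinM mulrCA -expRD subrK.
  - apply/measurable_EFinP; apply: measurableT_comp => //.
    apply: measurable_funD; first by apply: measurable_funM => //; exact: measurable_funX.
    exact: measurable_funM.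
have := ge0_le_integral_independent_head indX mF _ mG FG.
have F0 z : 0 <= F z by rewrite lee_fin expR_ge0.
move=> /(_ F0) le_FG.
rewrite [leLHS](_ : _ =
    \int[P]_w F (X ord0 w, [tuple X (lift ord0 i) w | i < n])); last first.
  apply: eq_integral => w _; congr (expR _)%:E => /=.
  set t := mktuple _.
  have tE i : tnth t i = X (lift ord0 i) w by rewrite tnth_mktuple.
  pose y : 'cV[R]_n := (\col_i tnth t i)%R.
  have yE : (\col_i random_vector X w (lift ord0 i) 0)%R = y.
    by apply/matrixP => i j; rewrite !mxE tE.
  rewrite qfS // big_ord_recl /r /q /b yE -/y -/p -/S' mxE.
  under [X in (_ + X - _)%R]eq_bigr do rewrite -tE.
  under [X in (X / p)%R]eq_bigr do rewrite mxE.
  by field; apply/andP.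
apply: (le_trans le_FG); rewrite detS /G.
under eq_integral do rewrite EFinM.
rewrite ge0_integralZl //=; first last.
- apply/measurable_EFinP; apply: measurableT_comp => //.
  apply: (measurableT_comp mq); apply/measurable_fun_tnthP => i.
  rewrite (_ : _ \o _ = X (lift ord0 i)) //.
  by apply/funext => w /=; rewrite tnth_mktuple.
have -> : (Num.sqrt (p * \det S'))^-1%:E =
    (Num.sqrt p)^-1%:E * (Num.sqrt (\det S'))^-1%:E.
  by rewrite (sqrtrM _ (ltW p0)) invfM EFinM.
apply: lee_wpmul2l; first by rewrite lee_fin invr_ge0 sqrtr_ge0.
apply: le_trans leS'; rewrite le_eqVlt; apply/orP; left; apply/eqP.
apply: eq_integral => w _; congr (expR _)%:E; rewrite /q.
rewrite [X in quadratic_form _ X](_ : _ =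
    random_vector (fun i : 'I_n => X (lift ord0 i)) w).
  by under eq_bigr do rewrite tnth_mktuple.
by apply/matrixP => i j; rewrite !mxE tnth_mktuple.
Qed.

End quadratic_exponential_moment.

(** * Euclidean and operator norms *)

Lemma quadratic_form_dot (R : realType) n (M : 'M[R]_n) (x : 'cV[R]_n) :
  quadratic_form M x = \sum_i x i 0 * (M *m x) i 0.
Proof. by rewrite /quadratic_form -mulmxA mxE; apply: eq_bigr => i _; rewrite mxE. Qed.

Section operator_norm.
Context (R : realType) (n : nat).
Implicit Types (M : 'M[R]_n) (x : 'cV[R]_n).

Lemma euclidean_norm_ge0 x : 0 <= euclidean_norm x.
Proof. exact: sqrtr_ge0. Qed.

Lemma sqr_euclidean_norm x : euclidean_norm x ^+ 2 = \sum_i x i 0 ^+ 2.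
Proof. by rewrite sqr_sqrtr // sumr_ge0 // => i _; exact: sqr_ge0. Qed.

Lemma euclidean_normZ (a : R) x : euclidean_norm (a *: x) = `|a| * euclidean_norm x.
Proof.
rewrite /euclidean_norm -sqrtr_sqr -sqrtrM ?sqr_ge0 // mulr_sumr.
by congr Num.sqrt; apply: eq_bigr => i _; rewrite mxE exprMn.
Qed.

Lemma euclidean_norm_eq0 x : (euclidean_norm x == 0) = (x == 0).
Proof.
rewrite -sqrf_eq0 sqr_euclidean_norm psumr_eq0; last by move=> i _; exact: sqr_ge0.
apply/allP/eqP => [x0|-> i _]; last by rewrite mxE expr0n eqxx.
apply/matrixP => i j; rewrite ord1 mxE; apply/eqP.
by have := x0 i (mem_index_enum i); rewrite sqrf_eq0.
Qed.

Lemma euclidean_norm0 : euclidean_norm (0 : 'cV[R]_n) = 0.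
Proof. by apply/eqP; rewrite euclidean_norm_eq0. Qed.

Lemma euclidean_norm_gt0 x : (0 < euclidean_norm x) = (x != 0).
Proof. by rewrite lt_def euclidean_norm_eq0 euclidean_norm_ge0 andbT. Qed.

(** Entries of a vector in the unit ball are at most 1 in absolute value, so each entry of the image
    is bounded by an absolute row sum. *)
Lemma has_sup_operator_norm M :
  has_sup [set euclidean_norm (M *m x) |
    x in [set x : 'cV[R]_n | euclidean_norm x <= 1]].
Proof.
split.
  exists (euclidean_norm (M *m 0)); exists 0 => //=.
  by rewrite euclidean_norm0.
exists (Num.sqrt (\sum_i (\sum_j `|M i j|) ^+ 2)) => _ [x /= x1 <-].
apply: ler_wsqrtr; apply: ler_sum => i _.
rewrite -real_normK ?num_real // lerXn2r ?nnegrE ?sumr_ge0 // mxE.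
apply: (le_trans (ler_norm_sum _ _ _)); apply: ler_sum => j _.
rewrite normrM ler_piMr //.
rewrite -(@ler_pXn2r _ 2) ?nnegrE // expr1n real_normK ?num_real //.
apply: (@le_trans _ _ (euclidean_norm x ^+ 2)).
  rewrite sqr_euclidean_norm (bigD1 j) //= lerDl sumr_ge0 // => k _; exact: sqr_ge0.
by rewrite -(expr1n _ 2) lerXn2r ?nnegrE ?euclidean_norm_ge0.
Qed.

Lemma operator_norm_ge0 M : 0 <= operator_norm M.
Proof.
apply: (le_trans (euclidean_norm_ge0 (M *m 0))).
apply: (ub_le_sup (proj2 (has_sup_operator_norm M))); exists 0 => //=.
by rewrite euclidean_norm0.
Qed.

Lemma euclidean_norm_mulmx_le M x :
  euclidean_norm (M *m x) <= operator_norm M * euclidean_norm x.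
Proof.
have [->|x0] := eqVneq x 0; first by rewrite mulmx0 euclidean_norm0 mulr0.
have nx0 : 0 < euclidean_norm x by rewrite euclidean_norm_gt0.
rewrite -ler_pdivrMr //; apply: (ub_le_sup (proj2 (has_sup_operator_norm M))).
exists ((euclidean_norm x)^-1 *: x) => /=.
  by rewrite euclidean_normZ ger0_norm ?invr_ge0 ?(ltW nx0) // mulVf // gt_eqF.
by rewrite -scalemxAr euclidean_normZ ger0_norm ?invr_ge0 ?(ltW nx0) // mulrC.
Qed.

(** Cauchy-Schwarz for [x] and [M *m x], summed from a weighted inequality on entries. The weight is
    [k] itself, hence the separate case [k = 0]. *)
Lemma quadratic_form_le_operator_norm M x :
  `|quadratic_form M x| <= operator_norm M * \sum_i x i 0 ^+ 2.
Proof.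
rewrite quadratic_form_dot -sqr_euclidean_norm.
set y := M *m x; set k := operator_norm M; set a := euclidean_norm x.
have a0 : 0 <= a := euclidean_norm_ge0 x.
have yk : euclidean_norm y <= k * a := euclidean_norm_mulmx_le M x.
have [k0|k0] := eqVneq k 0.
  have y0 : y = 0.
    apply/eqP; rewrite -euclidean_norm_eq0 eq_le euclidean_norm_ge0 andbT.
    by move: yk; rewrite k0 mul0r.
  by rewrite big1 ?normr0 ?mulr_ge0 ?sqr_ge0 ?operator_norm_ge0 // => i _; rewrite y0 mxE mulr0.
have kp : 0 < k by rewrite lt_def k0 operator_norm_ge0.
(* AM-GM: 2 |u v| <= k u^2 + v^2 / k *)
apply: (@le_trans _ _ (\sum_i (k * x i 0 ^+ 2 + y i 0 ^+ 2 / k) / 2)).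
  apply: (le_trans (ler_norm_sum _ _ _)); apply: ler_sum => i _.
  set u := x i 0; set v := y i 0.
  have : 0 <= (k * `|u| - `|v|) ^+ 2 / k by rewrite divr_ge0 ?sqr_ge0 // ltW.
  have -> : (k * `|u| - `|v|) ^+ 2 / k = k * `|u| ^+ 2 + `|v| ^+ 2 / k - 2 * (`|u| * `|v|).
    by field; rewrite gt_eqF.
  by rewrite !real_normK ?num_real // normrM; lra.
rewrite -mulr_suml big_split /= -mulr_sumr -mulr_suml -!sqr_euclidean_norm -/a.
have : euclidean_norm y ^+ 2 / k <= k * a ^+ 2.
  rewrite ler_pdivrMr // mulrAC -expr2 -exprMn.
  by rewrite lerXn2r ?nnegrE ?euclidean_norm_ge0 ?mulr_ge0 ?(ltW kp).
lra.
Qed.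

Lemma norm_diag_le_operator_norm M i : `|M i i| <= operator_norm M.
Proof.
have := quadratic_form_le_operator_norm M (delta_mx i 0).
rewrite quadratic_form_dot (bigD1 i) //= [X in _ + X]big1 ?addr0; last first.
  by move=> j ji; rewrite !mxE (negbTE ji) mul0r.
rewrite [X in _ <= _ * X](bigD1 i) //= [X in _ <= _ * (_ + X)]big1 ?addr0; last first.
  by move=> j ji; rewrite !mxE (negbTE ji) expr0n.
rewrite -colE !mxE !eqxx mul1r expr1n mulr1; exact.
Qed.

Lemma operator_norm_eq0 M : operator_norm M = 0 -> M = 0.
Proof.
move=> M0; apply/matrixP => i j.
have := euclidean_norm_mulmx_le M (delta_mx j 0); rewrite M0 mul0r => y0.
have : M *m delta_mx j 0 = 0 :> 'cV_n.
  by apply/eqP; rewrite -euclidean_norm_eq0 eq_le y0 euclidean_norm_ge0.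
by rewrite -colE => /matrixP/(_ i 0); rewrite !mxE.
Qed.

Lemma sqr_frobenius_norm M : frobenius_norm M ^+ 2 = \sum_i \sum_j M i j ^+ 2.
Proof.
by rewrite sqr_sqrtr // sumr_ge0 // => i _; rewrite sumr_ge0 // => j _; exact: sqr_ge0.
Qed.

End operator_norm.

(** * Determinants of trace-free perturbations of the identity *)

(** The claim becomes 1 <= exp(r + r^2) (1 - r). For r <= 0 the bound 1 + y <= exp y suffices, since
    (1 + r + r^2) (1 - r) = 1 - r^3. *)
Lemma expRN_sqr_le_onem (R : realType) (r : R) : `|r| <= 2 / 3 ->
  expR (- (r + r ^+ 2)) <= 1 - r.
Proof.
rewrite ler_norml => /andP[lo hi].
have r1 : 0 < 1 - r by lra.
rewrite expRN invf_ple ?posrE ?expR_gt0 //.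
rewrite -[leLHS]mul1r ler_pdivrMr //.
have [r0|r0] := leP r 0.
  apply: (@le_trans _ _ ((1 + (r + r ^+ 2)) * (1 - r))); last first.
    by rewrite ler_wpM2r ?expR_ge1Dx // ltW.
  have : 0 <= r ^+ 2 * - r by rewrite mulr_ge0 ?sqr_ge0 // oppr_ge0.
  by lra.
have y0 : 0 <= r + r ^+ 2 by nra.
(* The inequality is nearly tight at r = 2 / 3: the Taylor polynomial of degree 4
   of the exponential suffices, that of degree 3 does not. *)
have := expR_ge_series 5 y0.
rewrite /series /= !big_nat_recl // big_geq // /exp_coeff /= => le_exp.
apply: (@le_trans _ _ ((1 + (r + r ^+ 2) + (r + r ^+ 2) ^+ 2 / 2 +
    (r + r ^+ 2) ^+ 3 / 6 + (r + r ^+ 2) ^+ 4 / 24) * (1 - r))); last first.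
  rewrite ler_wpM2r ?(ltW r1) //; apply: le_trans le_exp.
  rewrite (_ : 4`! = 24%N) // (_ : 3`! = 6%N) // (_ : 2`! = 2%N) //.
  rewrite (_ : 1`! = 1%N) // (_ : 0`! = 1%N) // expr0 expr1 addr0 !divr1.
  by rewrite le_eqVlt; apply/orP; left; apply/eqP; field.
have pr k : r ^+ k <= (2 / 3) ^+ k by rewrite lerXn2r ?nnegrE //; lra.
(* In the cofactor of [r ^+ 2] all coefficients after the constant are negative, so it is least at r
   = 2 / 3, where it is still positive. *)
rewrite -subr_ge0 [leRHS](_ : _ = r ^+ 2 * (1 / 2 - r / 3 - r ^+ 2 / 8 -
  3 * r ^+ 3 / 8 - r ^+ 4 / 4 - r ^+ 5 / 4 - r ^+ 6 / 8 - r ^+ 7 / 24)); last by field.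
rewrite mulr_ge0 ?sqr_ge0 //.
have := (pr 2, pr 3, pr 4, pr 5, pr 6, pr 7).
by move=> [[[[[]]]]]; lra.
Qed.

Section real_spectrum.
Context (R : realType) (n : nat) (B : 'M[R]_n).
Hypothesis B_sym : B^T = B.

Let toC : {rmorphism R -> R[i]} := real_complex R.
Let A : 'M[R[i]]_n := map_mx toC B.

Let A_real : A \is a realmx.
Proof. by apply/mxOverP => i j; rewrite mxE; apply/complex_realP; exists (B i j). Qed.

Let A_herm : A \is hermsymmx.
Proof.
apply: realsym_hermsym => //; apply/is_hermitianmxP.
by rewrite expr0 scale1r map_mx_id // /A map_trmx B_sym.
Qed.

Let U := spectralmx A.
Let eigval : 'rV[R]_n := \row_i complex.Re (spectral_diag A 0 i).

Let eigvalE : spectral_diag A = map_mx toC eigval.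
Proof.
apply/matrixP => i j; rewrite ord1 !mxE; apply/esym/RRe_real.
exact: (mxOverP (hermitian_spectral_diag_real A_herm)).
Qed.

Let A_diag : A = invmx U *m map_mx toC (diag_mx eigval) *m U.
Proof.
rewrite map_diag_mx -eigvalE.
exact: (orthomx_spectralP (hermitian_normalmx A_herm)).
Qed.

Let U_unit : U \in unitmx. Proof. exact: spectral_unit. Qed.

(** The complexified matrix is Hermitian, hence unitarily diagonalizable with real eigenvalues; the
    determinant and the traces descend by injectivity of the embedding of the reals. *)
Lemma real_symmetric_spectrum : exists r : 'rV[R]_n,
  [/\ \det (1%:M - B) = \prod_i (1 - r 0 i),
      \tr B = \sum_i r 0 i,
      \tr (B *m B) = \sum_i r 0 i ^+ 2 &
      forall i, exists2 x : 'cV[R]_n, x != 0 & B *m x = r 0 i *: x].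
Proof.
exists eigval; split.
- apply: (@complexI R); rewrite -/toC rmorph_prod -det_map_mx map_mxB map_mx1 -/A.
  have -> : 1%:M - A = invmx U *m map_mx toC (diag_mx (\row_i (1 - eigval 0 i))) *m U.
    have -> : map_mx toC (diag_mx (\row_i (1 - eigval 0 i))) =
        1%:M - map_mx toC (diag_mx eigval).
      apply/matrixP => i j; rewrite !mxE.
      by case: eqP => _; rewrite ?mulr1n ?rmorphB ?rmorph1 // !mulr0n rmorph0 subr0.
    by rewrite mulmxBr mulmxBl mulmx1 mulVmx // -A_diag.
  rewrite !det_mulmx mulrAC -det_mulmx mulVmx // det1 mul1r det_map_mx det_diag rmorph_prod.
  by apply: eq_bigr => i _; rewrite mxE.
- apply: (@complexI R); rewrite -/toC -trace_map_mx -/A A_diag mxtrace_mulC mulmxA.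
  by rewrite mulmxV // mul1mx trace_map_mx mxtrace_diag.
- apply: (@complexI R); rewrite -/toC -trace_map_mx map_mxM -/A A_diag.
  rewrite !mulmxA -[X in X *m _ *m _]mulmxA mulmxV // mulmx1 mxtrace_mulC.
  rewrite !mulmxA mulmxV // mul1mx -map_mxM mulmx_diag.
  rewrite trace_map_mx mxtrace_diag; congr (toC _); apply: eq_bigr => i _.
  by rewrite !mxE.
(* The rows of [U] are left eigenvectors; since [A] is symmetric, their transposes are right
   eigenvectors. *)
- move=> i; pose z : 'cV[R[i]]_n := (row i U)^T.
  have Az : A *m z = toC (eigval 0 i) *: z.
    have AT : A^T = A by rewrite /A map_trmx B_sym.
    rewrite -{1}AT -trmx_mul -row_mul {1}A_diag !mulmxA mulmxV // mul1mx.
    by rewrite map_diag_mx mul_diag_mx; apply/matrixP => j k; rewrite !mxE.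
  have z0 : z != 0.
    apply/eqP => /(congr1 trmx); rewrite trmxK trmx0 => z0.
    have /(congr1 (row i)) := mulmxV U_unit.
    rewrite row_mul z0 mul0mx => /matrixP/(_ 0 i)/eqP.
    by rewrite !mxE eqxx eq_sym oner_eq0.
  (* Real and imaginary parts commute with real scalars, so both send [z] into the real eigenspace,
     and one of them is nonzero. *)
  have part (f : R[i] -> R) : {morph f : v w / v + w} -> f 0 = 0 ->
      (forall a w, f (toC a * w) = a * f w) ->
      B *m map_mx f z = eigval 0 i *: map_mx f z.
    move=> fD f0 fM; apply/matrixP => j k; have /matrixP/(_ j k) := Az.
    rewrite !mxE => /(congr1 f); rewrite fM => <-; rewrite (big_morph f fD f0).
    by apply: eq_bigr => l _; rewrite !mxE fM.
  have [re0|re0] := eqVneq (map_mx (@complex.Re R) z) 0; last first.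
    exists (map_mx (@complex.Re R) z) => //; apply: part => // [[? ?] [? ?] //|a [b c]].
    by rewrite /= mul0r subr0.
  exists (map_mx (@complex.Im R) z); last first.
    apply: part => // [[? ?] [? ?] //|a [b c]].
    by rewrite /= mul0r addr0.
  apply: contra_neq z0 => im0; apply/matrixP => j k.
  have /matrixP/(_ j k) := re0; have /matrixP/(_ j k) := im0.
  by rewrite !mxE; case: (U i j) => a b /= -> ->.
Qed.

End real_spectrum.

(** Multiply the scalar bound over the eigenvalues: they sum to the trace, which is 0, their squares
    sum to the trace of B^2, which is the squared Frobenius norm by symmetry, and the form at
    eigenvectors keeps them within 2 / 3. *)
Lemma det_onem_ge (R : realType) n (B : 'M[R]_n) :
  B^T = B -> \tr B = 0 ->
  (forall x : 'cV[R]_n,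
    `|quadratic_form B x| <= 2 / 3 * \sum_i x i 0 ^+ 2) ->
  expR (- \sum_i \sum_j B i j ^+ 2) <= \det (1%:M - B).
Proof.
move=> symB trB qB.
have [r [-> trr trr2 eigr]] := real_symmetric_spectrum symB.
have -> : \sum_i \sum_j B i j ^+ 2 = \sum_i (r 0 i + r 0 i ^+ 2).
  rewrite big_split /= -trr trB add0r -trr2 /mxtrace.
  apply: eq_bigr => i _; rewrite mxE; apply: eq_bigr => j _.
  by rewrite expr2 -[in X in _ = _ * X]symB mxE.
rewrite -sumrN expR_sum; apply: ler_prod => i _.
rewrite expR_ge0 /= expRN_sqr_le_onem //.
have [x x0 Bx] := eigr i.
have x2 : 0 < \sum_j x j 0 ^+ 2.
  by rewrite -sqr_euclidean_norm exprn_gt0 // euclidean_norm_gt0.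
have qx : quadratic_form B x = r 0 i * \sum_j x j 0 ^+ 2.
  rewrite quadratic_form_dot Bx mulr_sumr.
  by apply: eq_bigr => j _; rewrite mxE mulrCA expr2.
have := qB x; rewrite qx normrM (gtr0_norm x2).
by rewrite ler_pM2r.
Qed.

(** * Exponential moments *)

(** The parameter [beta] lets the bound serve both a diagonal-free matrix, with its operator norm,
    and the off-diagonal part of a general one, with twice the operator norm of the whole. *)
Lemma diagonal_free_mgf_le d (T : measurableType d) (R : realType)
    (P : probability T R) n (X : 'I_n -> {RV P >-> R}) (s : R) (M : 'M[R]_n)
    (beta lambda : R) :
  0 < s -> mutually_independent X -> (forall i, sub_gaussian (X i) s) ->
  (forall i, M i i = 0) ->
  (forall x, `|quadratic_form M x| <= beta * \sum_i x i 0 ^+ 2) ->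
  3 * s * `|lambda| * beta <= 1 ->
  (\int[P]_w (expR (lambda * quadratic_form M (random_vector X w)))%:E <=
   (expR (2 * lambda ^+ 2 * s ^+ 2 * \sum_i \sum_j M i j ^+ 2))%:E)%E.
Proof.
move=> s0 indX subX diagM qM lam.
(* Symmetrizing doubles the form, so [lambda] times the form of [M] is that of [B] over [2 * s]; the
   range of [lambda] puts the form of [B] within 2 / 3. *)
pose B := (lambda * s) *: (M + M^T).
have symB : B^T = B by rewrite /B linearZ /= linearD /= trmxK addrC.
have qB x : quadratic_form B x = 2 * lambda * s * quadratic_form M x.
  rewrite -[2]/(1 + 1) !mulrDl !mul1r {1}quadratic_formE.
  under eq_bigr do under eq_bigr do rewrite !mxE mulrDr !mulrDl.
  under eq_bigr do rewrite big_split.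
  rewrite big_split /= [X in _ + X]exchange_big /= quadratic_formE !mulr_sumr.
  congr (_ + _); apply: eq_bigr => i _; rewrite mulr_sumr; apply: eq_bigr => j _.
    by rewrite !mulrA.
  by rewrite -!mulrA; do 3! congr (_ * _); rewrite mulrC.
have trB : \tr B = 0.
  by rewrite /mxtrace big1 // => i _; rewrite !mxE diagM addr0 mulr0.
have leB x : `|quadratic_form B x| <= 2 / 3 * \sum_i x i 0 ^+ 2.
  rewrite qB !normrM (gtr0_norm s0) ger0_norm //.
  have x2 : 0 <= \sum_i x i 0 ^+ 2 by apply: sumr_ge0 => i _; exact: sqr_ge0.
  apply: (@le_trans _ _ (2 * `|lambda| * s * (beta * \sum_i x i 0 ^+ 2))).
    by rewrite ler_wpM2l // !mulr_ge0 // ltW.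
  have := ler_wpM2r x2 lam; lra.
have qS x : quadratic_form (1%:M - B) x = \sum_i x i 0 ^+ 2 - quadratic_form B x.
  rewrite /quadratic_form mulmxBr mulmxBl mulmx1 !mxE; congr (_ - _).
  by apply: eq_bigr => i _; rewrite mxE expr2.
have [|||detS le_det] :=
    @det_posdef_gt0_sub_gaussian_expR_le _ _ _ P s n X (1%:M - B) s0 indX subX.
- by rewrite linearB /= trmx1 symB.
- move=> x x0; rewrite qS subr_gt0; apply: (le_lt_trans (ler_norm _)).
  apply: (le_lt_trans (leB x)).
  have : 0 < \sum_i x i 0 ^+ 2.
    by rewrite -sqr_euclidean_norm exprn_gt0 // euclidean_norm_gt0.
  lra.
- by move=> i; rewrite !mxE diagM addr0 mulr0 subr0 eqxx.
rewrite [leLHS](_ : _ = \int[P]_w (expR ((\sum_i X i w ^+ 2 -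
    quadratic_form (1%:M - B) (random_vector X w)) / (2 * s)))%:E)%E; last first.
  apply: eq_integral => w _; congr (expR _)%:E.
  rewrite qS; under [X in _ = (_ - (X - _)) / _]eq_bigr do rewrite mxE.
  by rewrite opprB addrC subrK qB; field; rewrite gt_eqF.
apply: (le_trans le_det); rewrite lee_fin.
set N := \sum_i \sum_j B i j ^+ 2.
(* Entrywise (x + y)^2 <= 2 x^2 + 2 y^2. *)
have leN : N <= 4 * lambda ^+ 2 * s ^+ 2 * \sum_i \sum_j M i j ^+ 2.
  apply: (@le_trans _ _ (2 * lambda ^+ 2 * s ^+ 2 *
      (\sum_i \sum_j M i j ^+ 2 + \sum_i \sum_j M j i ^+ 2))).
    rewrite -big_split mulr_sumr; apply: ler_sum => i _ /=.
    rewrite -big_split mulr_sumr; apply: ler_sum => j _ /=.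
    rewrite !mxE exprMn.
    have := mulr_ge0 (sqr_ge0 (lambda * s)) (sqr_ge0 (M i j - M j i)); lra.
  rewrite [X in _ + X]exchange_big /=; lra.
apply: (@le_trans _ _ (expR (N / 2))); last by rewrite ler_expR; lra.
rewrite -[X in expR X]opprK expRN lef_pV2 ?posrE ?sqrtr_gt0 ?expR_gt0 //.
rewrite -(@ler_pXn2r _ 2) ?nnegrE ?expR_ge0 ?sqrtr_ge0 // sqr_sqrtr ?(ltW detS) //.
apply: le_trans (det_onem_ge symB trB leB).
by rewrite -expRM_natl ler_expR /N; lra.
Qed.

Lemma independent_integral_expR_sum_le d (T : measurableType d) (R : realType)
    (P : probability T R) n (X : 'I_n -> {RV P >-> R})
    (f : 'I_n -> R -> R) (c : 'I_n -> R) :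
  mutually_independent X -> (forall i, measurable_fun setT (f i)) ->
  (forall i, (\int[P]_w (expR (f i (X i w)))%:E <= (expR (c i))%:E)%E) ->
  (\int[P]_w (expR (\sum_i f i (X i w)))%:E <= (expR (\sum_i c i))%:E)%E.
Proof.
elim: n X f c => [|n IH] X f c indX mf fc.
  under eq_integral => w _ do rewrite big_ord0.
  by rewrite big_ord0 integral_cst //= probability_setT mule1.
have indX' := mutually_independent_comp (@lift_inj _ ord0) indX.
have {IH} := IH _ (f \o lift ord0) (c \o lift ord0) indX'
  (fun i => mf _) (fun i => fc _).
rewrite /= => IH.
pose g (t : n.-tuple R) := \sum_i f (lift ord0 i) (tnth t i).
have mg : measurable_fun setT g.
  apply: measurable_sum => i; apply: measurableT_comp => //.
  exact: measurable_tnth.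
pose F (z : R * n.-tuple R) := (expR (f ord0 z.1 + g z.2))%:E.
pose G (t : n.-tuple R) := ((expR (c ord0))%:E * (expR (g t))%:E)%E.
have mF : measurable_fun setT F.
  apply/measurable_EFinP; apply: measurableT_comp => //.
  by apply: measurable_funD; exact: measurableT_comp.
have mG : measurable_fun setT G.
  apply: measurable_funeM; apply/measurable_EFinP; exact: measurableT_comp.
have F0 z : (0 <= F z)%E by rewrite lee_fin expR_ge0.
have FG t : (\int[P]_w F (X ord0 w, t) <= G t)%E.
  rewrite /F /=; under eq_integral do rewrite expRD EFinM.
  rewrite ge0_integralZr //=.
  - by rewrite lee_wpmul2r ?lee_fin ?expR_ge0.
  - by apply/measurable_EFinP; apply: measurableT_comp => //; exact: measurableT_comp.
have := ge0_le_integral_independent_head indX mF F0 mG FG.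
have gE w : g [tuple X (lift ord0 i) w | i < n] = \sum_i f (lift ord0 i) (X (lift ord0 i) w).
  by apply: eq_bigr => i _; rewrite tnth_mktuple.
rewrite /F /G /=; under eq_integral do rewrite gE.
under [X in (_ <= X)%E]eq_integral do rewrite gE.
rewrite ge0_integralZl //=; last first.
  apply/measurable_EFinP; apply: measurableT_comp => //.
  by apply: measurable_sum => i; exact: measurableT_comp.
under [X in _ -> (X <= _)%E]eq_integral do rewrite big_ord_recl.
move=> /le_trans; apply; rewrite big_ord_recl expRD EFinM.
by rewrite lee_wpmul2l ?lee_fin ?expR_ge0.
Qed.

(** From 1 + l m <= E exp(l Z) <= exp(l^2 C), a nonzero mean m is contradicted for small l of the
    sign of m. This gives the mean of the off-diagonal form without expanding it into products of
    variables. *)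
Lemma mgf_quadratic_mean0 d (T : measurableType d) (R : realType)
    (P : probability T R) (Z : T -> R) (delta C : R) :
  measurable_fun setT Z -> 0 < delta -> 0 <= C ->
  (forall l, `|l| <= delta ->
    (\int[P]_w (expR (l * Z w))%:E <= (expR (l ^+ 2 * C))%:E)%E) ->
  P.-integrable setT (EFin \o Z) /\ (\int[P]_w (Z w)%:E = 0)%E.
Proof.
move=> mZ delta0 C0 mgf.
have mexp l : measurable_fun setT (fun w => expR (l * Z w)).
  by apply: measurableT_comp => //; exact: measurable_funM.
have intexp l : `|l| <= delta -> P.-integrable setT (EFin \o (fun w => expR (l * Z w))).
  move=> ld; apply/integrableP; split; first exact/measurable_EFinP.
  under eq_integral do rewrite /= ger0_norm ?expR_ge0 //.
  by apply: le_lt_trans (mgf l ld) _; rewrite ltry.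
(* Domination of |Z| by (exp(delta Z) + exp(- delta Z)) / delta. *)
have intZ : P.-integrable setT (EFin \o Z).
  have d1 : `|delta| <= delta by rewrite gtr0_norm.
  have d2 : `|- delta| <= delta by rewrite normrN gtr0_norm.
  have int := integrableZl measurableT delta^-1
    (integrableD measurableT (intexp _ d1) (intexp _ d2)).
  apply: le_integrable int => //; first exact/measurable_EFinP.
  move=> w _; rewrite lee_fin /=.
  rewrite [leRHS]ger0_norm ?mulr_ge0 ?addr_ge0 ?expR_ge0 ?invr_ge0 ?(ltW delta0) //.
  rewrite mulrC ler_pdivlMr //.
  have [z0|z0] := leP 0 (Z w).
    have := expR_ge1Dx (delta * Z w); have := expR_ge0 (- delta * Z w).
    by rewrite ger0_norm //; lra.
  have := expR_ge1Dx (- delta * Z w); have := expR_ge0 (delta * Z w).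
  by rewrite ltr0_norm //; lra.
split=> //.
have fin := integrable_fin_num measurableT intZ.
pose m := fine (\int[P]_w (Z w)%:E)%E.
have mE : (\int[P]_w (Z w)%:E = m%:E)%E by rewrite fineK.
have lin l : `|l| <= delta -> 1 + l * m <= expR (l ^+ 2 * C).
  move=> ld; rewrite -lee_fin; apply: le_trans (mgf l ld).
  rewrite EFinD EFinM -mE -integralZl //.
  rewrite -[X in (X + _)%E](_ : (\int[P]_w (cst 1%:E w) = 1)%E); last first.
    by rewrite integral_cst //= probability_setT mule1.
  have int1 : P.-integrable setT (EFin \o cst (1 : R)).
    exact: finite_measure_integrable_cst.
  have intl := integrableZl measurableT l intZ.
  rewrite -integralD //; apply: le_integral => //=.
  - exact: (integrableD measurableT int1 intl).
  - exact: intexp.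
  - by move=> w _; rewrite -EFinM -EFinD lee_fin expR_ge1Dx.
(* With v = l^2 C, multiplying 1 + l |m| <= exp v by 1 - v and using (1 - v) exp v <= 1 gives l |m|
   <= v + v l |m| <= 2 v. *)
have key l : 0 <= l -> l <= delta -> l ^+ 2 * C <= 1 -> l * `|m| <= 1 ->
    l * `|m| <= 2 * (l ^+ 2 * C).
  move=> l0 ld lC lm.
  have [eps [e1 em]] : exists eps : R, `|eps| = 1 /\ eps * m = `|m|.
    have [m0|m0] := leP 0 m; [exists 1|exists (-1)].
      by rewrite normr1 mul1r ger0_norm.
    by rewrite normrN1 mulN1r ltr0_norm.
  have := lin (l * eps); rewrite normrM e1 mulr1 ger0_norm // => /(_ ld).
  rewrite -mulrA em exprMn -[eps ^+ 2]real_normK ?num_real // e1 expr1n mulr1.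
  set v := l ^+ 2 * C => le1.
  have := expR_ge1Dx (- v); rewrite expRN => le2.
  have := expR_gt0 v => e0.
  have : (1 - v) * expR v <= 1 by rewrite -ler_pdivlMr // mul1r.
  have := ler_wpM2l (_ : 0 <= 1 - v) le1.
  rewrite subr_ge0 => /(_ lC).
  have : v * (l * `|m|) <= v by rewrite ler_piMr // mulr_ge0 ?sqr_ge0.
  lra.
rewrite mE; congr EFin; apply/eqP; rewrite -normr_eq0; apply/negPn/negP => m0.
have mp : 0 < `|m| by rewrite lt_def m0 normr_ge0.
(* A sum of all the lower bounds required of 1 / l. The last one yields l (2 C + 1) <= |m|, against
   |m| <= 2 l C from [key]. *)
pose K := delta^-1 + (1 + C) + `|m| + (2 * C + 1) / `|m|.
have [k1 k2] : 0 < delta^-1 /\ 0 < (2 * C + 1) / `|m|.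
  by split; [rewrite invr_gt0 | rewrite divr_gt0 // ltr_wpDl // mulr_ge0].
have K0 : 0 < K by rewrite /K; lra.
pose l := K^-1; have l0 : 0 < l by rewrite invr_gt0.
have lK : l * K = 1 by rewrite mulVf // gt_eqF.
have lle x : 0 <= x -> x <= K -> l * x <= 1 by move=> x0 xK; rewrite -lK ler_wpM2l // ltW.
have ld : l <= delta.
  by rewrite -[delta]mul1r -ler_pdivrMr //; apply: lle; [exact: ltW | rewrite /K; lra].
have lm : l * `|m| <= 1 by apply: lle => //; rewrite /K; lra.
have l1 : l <= 1 by rewrite -[l]mulr1; apply: lle => //; rewrite /K; lra.
have lC' : l * C <= 1 by apply: lle => //; rewrite /K; lra.
have lC : l ^+ 2 * C <= 1.
  by rewrite expr2 -mulrA; apply: le_trans lC'; rewrite ler_piMl // mulr_ge0 // ltW.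
have := key l (ltW l0) ld lC lm.
have -> : 2 * (l ^+ 2 * C) = l * (2 * (l * C)) by ring.
rewrite ler_pM2l // => bad.
have : l * ((2 * C + 1) / `|m|) <= 1 by apply: lle; [exact: ltW | rewrite /K; lra].
rewrite mulrA ler_pdivrMr // mul1r; lra.
Qed.

Lemma random_vectorE d (T : measurableType d) (R : realType)
    (P : probability T R) n (X : 'I_n -> {RV P >-> R}) w i :
  random_vector X w i 0 = X i w.
Proof. by rewrite mxE. Qed.

Lemma measurable_quadratic_form d (T : measurableType d) (R : realType)
    (P : probability T R) n (X : 'I_n -> {RV P >-> R}) (M : 'M[R]_n) :
  measurable_fun setT (fun w => quadratic_form M (random_vector X w)).
Proof.
under eq_fun do rewrite quadratic_formE.
apply: measurable_sum => i; apply: measurable_sum => j.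
under eq_fun do rewrite !random_vectorE.
by apply: measurable_funM => //; exact: measurable_funM.
Qed.

(** * Diagonal and off-diagonal parts *)

Definition offdiag_mx (R : realType) n (M : 'M[R]_n) : 'M[R]_n :=
  \matrix_(i, j) (if i == j then 0 else M i j).

Section offdiag.
Context (R : realType) (n : nat) (M : 'M[R]_n).

Lemma offdiag_mx_diag i : offdiag_mx M i i = 0.
Proof. by rewrite mxE eqxx. Qed.

Lemma quadratic_form_offdiag (x : 'cV[R]_n) :
  quadratic_form M x =
  quadratic_form (offdiag_mx M) x + \sum_i M i i * x i 0 ^+ 2.
Proof.
rewrite !quadratic_formE -big_split; apply: eq_bigr => i _ /=.
rewrite (bigD1 i) //= [in RHS](bigD1 i) //= mxE eqxx !mul0r add0r addrC -mulrA expr2.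
congr (_ + _); apply: eq_bigr => j ji; by rewrite mxE eq_sym (negbTE ji).
Qed.

(** Both the full form and its diagonal part are bounded by the operator norm, as diagonal entries
    are values of the form at basis vectors. *)
Lemma quadratic_form_offdiag_le (x : 'cV[R]_n) :
  `|quadratic_form (offdiag_mx M) x| <= 2 * operator_norm M * \sum_i x i 0 ^+ 2.
Proof.
have -> : quadratic_form (offdiag_mx M) x =
    quadratic_form M x - \sum_i M i i * x i 0 ^+ 2.
  by rewrite quadratic_form_offdiag addrK.
apply: (le_trans (ler_normB _ _)); rewrite mulr_natl mulr2n mulrDl lerD //.
  exact: quadratic_form_le_operator_norm.
apply: (le_trans (ler_norm_sum _ _ _)); rewrite mulr_sumr; apply: ler_sum => i _.
rewrite normrM [`|x i 0 ^+ 2|]ger0_norm ?sqr_ge0 //.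
by rewrite ler_wpM2r ?sqr_ge0 // norm_diag_le_operator_norm.
Qed.

Lemma sqr_frobenius_norm_offdiag : frobenius_norm M ^+ 2 =
  \sum_i \sum_j offdiag_mx M i j ^+ 2 + \sum_i M i i ^+ 2.
Proof.
rewrite sqr_frobenius_norm -big_split; apply: eq_bigr => i _ /=.
rewrite (bigD1 i) //= [in RHS](bigD1 i) //= mxE eqxx expr0n add0r addrC.
congr (_ + _); apply: eq_bigr => j ji; by rewrite mxE eq_sym (negbTE ji).
Qed.

End offdiag.

(** * Mean and exponential moments of the quadratic form *)

Section hanson_wright.
Context d (T : measurableType d) (R : realType) (P : probability T R).
Variables (n : nat) (X : 'I_n -> {RV P >-> R}) (s : R) (M : 'M[R]_n).
Hypotheses (s_gt0 : 0 < s) (X_indep : mutually_independent X).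
Hypothesis X_subg : forall i, sub_gaussian (X i) s.

Let Q w := quadratic_form M (random_vector X w).
Let Q0 w := quadratic_form (offdiag_mx M) (random_vector X w).
Let mu i := fine (\int[P]_w (X i w ^+ 2)%:E)%E.

Let muE i : (\int[P]_w (X i w ^+ 2)%:E = (mu i)%:E)%E.
Proof.
rewrite fineK //; apply: integrable_fin_num => //.
exact: sub_gaussian_integrable_sqr s_gt0 (X_subg i).
Qed.

Let N := operator_norm M.

Let Q0_mgf l : 3 * s * `|l| * (2 * N) <= 1 ->
  (\int[P]_w (expR (l * Q0 w))%:E <=
   (expR (2 * l ^+ 2 * s ^+ 2 * \sum_i \sum_j offdiag_mx M i j ^+ 2))%:E)%E.
Proof.
apply: diagonal_free_mgf_le => //; first exact: offdiag_mx_diag.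
exact: quadratic_form_offdiag_le.
Qed.

Let F0 := \sum_i \sum_j offdiag_mx M i j ^+ 2.

Let F0_ge0 : 0 <= F0.
Proof. by apply: sumr_ge0 => i _; apply: sumr_ge0 => j _; exact: sqr_ge0. Qed.

Let N_ge0 : 0 <= N. Proof. exact: operator_norm_ge0. Qed.

Let Q0_mean : P.-integrable setT (EFin \o Q0) /\ (\int[P]_w (Q0 w)%:E = 0)%E.
Proof.
(* The summand 1 keeps [D] positive when the operator norm vanishes. *)
pose D := 6 * s * N + 1.
have D0 : 0 < D by rewrite /D; have := mulr_ge0 (ltW s_gt0) N_ge0; lra.
apply: (@mgf_quadratic_mean0 _ _ _ P Q0 D^-1 (2 * s ^+ 2 * F0)).
- exact: measurable_quadratic_form.
- by rewrite invr_gt0.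
- by rewrite mulr_ge0 // mulr_ge0 // sqr_ge0.
- move=> l ld; have := @Q0_mgf l.
  rewrite (_ : 2 * l ^+ 2 * s ^+ 2 * _ = l ^+ 2 * (2 * s ^+ 2 * F0)); last by rewrite /F0; ring.
  apply; have : `|l| * D <= 1 by rewrite -ler_pdivlMr // div1r.
  rewrite /D; have := normr_ge0 l; lra.
Qed.

Let m := \sum_i M i i * mu i.

Lemma expectation_quadratic_form : ('E_P[Q] = m%:E)%E.
Proof.
have [intQ0 EQ0] := Q0_mean.
have intX i : P.-integrable setT (fun w => (M i i)%:E * (X i w ^+ 2)%:E)%E.
  apply: integrableZl => //.
  exact: sub_gaussian_integrable_sqr s_gt0 (X_subg i).
rewrite unlock [LHS](_ : _ = \int[P]_w ((Q0 w)%:E +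
    \sum_i (M i i)%:E * (X i w ^+ 2)%:E))%E; last first.
  apply: eq_integral => w _; rewrite /Q quadratic_form_offdiag EFinD -sumEFin.
  by congr (_ + _)%E; apply: eq_bigr => i _; rewrite random_vectorE EFinM.
rewrite integralD //; last exact: integrable_sum.
rewrite EQ0 add0e integral_sum // -sumEFin; apply: eq_bigr => i _.
by rewrite integralZl ?muE // ; exact: sub_gaussian_integrable_sqr s_gt0 (X_subg i).
Qed.

Let c1 : R := if diagonal_free M then 2 else 20.
Let c2 : R := if diagonal_free M then 1 else 4.

Lemma quadratic_form_mgf_le l : 3 * c2 * N * s * `|l| <= 1 ->
  (\int[P]_w (expR (l * (Q w - m)))%:E <=
   (expR (l ^+ 2 * (c1 * s ^+ 2 * frobenius_norm M ^+ 2)))%:E)%E.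
Proof.
rewrite /c1 /c2; case: ifPn => [dfM|_] lN.
  have M0 i : M i i = 0 by exact/eqP/(forallP dfM).
  have -> : m = 0 by apply: big1 => i _; rewrite M0 mul0r.
  under eq_integral do rewrite subr0.
  apply: (@le_trans _ _ _ _ _ (diagonal_free_mgf_le s_gt0 X_indep X_subg M0
    (quadratic_form_le_operator_norm M) _)).
    by rewrite -/N; lra.
  by rewrite lee_fin ler_expR sqr_frobenius_norm; lra.
have s0 := ltW s_gt0.
(* Exponents for the two parts at [2 * l]. The off-diagonal part needs
   [3 * s * |2 * l| * (2 * N) <= 1] and the diagonal part [6 * s * |2 * l| * N <= 1]: both are the
   hypothesis with [c2 = 4]. *)
pose p := 2 * (2 * l) ^+ 2 * s ^+ 2 * F0.
pose v i := M i i * (2 * l).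
pose q := \sum_i 10 * (v i) ^+ 2 * s ^+ 2.
pose f i (x : R) := v i * (x ^+ 2 - mu i).
have leU : (\int[P]_w (expR (2 * l * Q0 w))%:E <= (expR p)%:E)%E.
  by apply: Q0_mgf; rewrite normrM ger0_norm //; lra.
have mf i : measurable_fun setT (f i).
  by apply: measurable_funM => //; exact: measurable_funB.
have leV : (\int[P]_w (expR (\sum_i f i (X i w)))%:E <= (expR q)%:E)%E.
  apply: independent_integral_expR_sum_le => // i.
  apply: sub_gaussian_sqr_mgf_le => //.
  rewrite /v !normrM (@ger0_norm _ 2) //.
  have := ler_wpM2r (mulr_ge0 s0 (normr_ge0 l)) (norm_diag_le_operator_norm M i).
  rewrite -/N; lra.
have mU : measurable_fun setT (fun w => (expR (2 * l * Q0 w))%:E).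
  apply/measurable_EFinP; apply: measurableT_comp => //; apply: measurable_funM => //.
  exact: measurable_quadratic_form.
have mV : measurable_fun setT (fun w => (expR (\sum_i f i (X i w)))%:E).
  apply/measurable_EFinP; apply: measurableT_comp => //.
  by apply: measurable_sum => i; exact: measurableT_comp.
(* Normalizing by [p] and [q] before using x y <= (x^2 + y^2) / 2 makes both terms integrate to at
   most [a], and [a + a] is exp((p + q) / 2), as Cauchy-Schwarz would give. *)
pose a := expR ((p + q) / 2) / 2.
have a0 : 0 <= a by rewrite divr_ge0 // expR_ge0.
apply: (@le_trans _ _ (\int[P]_w ((a * expR (- p))%:E * (expR (2 * l * Q0 w))%:E +
    (a * expR (- q))%:E * (expR (\sum_i f i (X i w)))%:E))%E).
  apply: ge0_le_integral => //.
  - apply/measurable_EFinP; apply: measurableT_comp => //; apply: measurable_funM => //.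
    by apply: measurable_funB => //; exact: measurable_quadratic_form.
  - by apply: emeasurable_funD; exact: measurable_funeM.
  move=> w _; rewrite -!EFinM -EFinD lee_fin.
  set U := 2 * l * Q0 w; set V := \sum_i _.
  have -> : l * (Q w - m) = (U + V) / 2.
    rewrite /Q quadratic_form_offdiag /U /V /f /m.
    have -> : \sum_i v i * (X i w ^+ 2 - mu i) = 2 * l *
        (\sum_i M i i * random_vector X w i 0 ^+ 2 - \sum_i M i i * mu i).
      rewrite -sumrB mulr_sumr; apply: eq_bigr => i _.
      by rewrite random_vectorE /v; ring.
    by rewrite /Q0; field.
  have -> : expR ((U + V) / 2) =
      expR ((p + q) / 2) * (expR ((U - p) / 2) * expR ((V - q) / 2)).
    by rewrite -!expRD; congr expR; field.
  have sq x : expR (x / 2) ^+ 2 = expR x by rewrite -expRM_natl; congr expR; field.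
  have -> : a * expR (- p) * expR U + a * expR (- q) * expR V =
      expR ((p + q) / 2) * ((expR ((U - p) / 2) ^+ 2 + expR ((V - q) / 2) ^+ 2) / 2).
    by rewrite !sq !(expRD, expRN) /a; field; rewrite !gt_eqF ?expR_gt0.
  rewrite ler_wpM2l ?expR_ge0 //.
  have := sqr_ge0 (expR ((U - p) / 2) - expR ((V - q) / 2)); lra.
have ap0 : (0%:E <= (a * expR (- p))%:E)%E by rewrite lee_fin mulr_ge0 ?expR_ge0.
have aq0 : (0%:E <= (a * expR (- q))%:E)%E by rewrite lee_fin mulr_ge0 ?expR_ge0.
rewrite ge0_integralD //; first last.
- exact: measurable_funeM.
- by move=> w _; rewrite mule_ge0 // lee_fin expR_ge0.
- exact: measurable_funeM.
- by move=> w _; rewrite mule_ge0 // lee_fin expR_ge0.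
rewrite !ge0_integralZl //.
apply: (@le_trans _ _ ((a * expR (- p))%:E * (expR p)%:E +
    (a * expR (- q))%:E * (expR q)%:E)%E).
  by rewrite leeD // lee_wpmul2l.
rewrite -!EFinM -EFinD lee_fin -!mulrA -!expRD !addNr expR0 !mulr1.
have -> : a + a = expR ((p + q) / 2) by rewrite /a; field.
(* In [(p + q) / 2] the off-diagonal squares have coefficient 4 l^2 s^2 and the diagonal ones 20 l^2
   s^2, whence [c1 = 20]. *)
rewrite ler_expR sqr_frobenius_norm_offdiag -/F0.
have -> : q = 40 * (l ^+ 2 * s ^+ 2) * \sum_i M i i ^+ 2.
  by rewrite mulr_sumr; apply: eq_bigr => i _; rewrite /v; ring.
have := mulr_ge0 (mulr_ge0 (sqr_ge0 l) (sqr_ge0 s)) F0_ge0; rewrite /p; lra.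
Qed.

End hanson_wright.

(** * From exponential moments to tail bounds *)

Lemma two_sided_chernoff d (T : measurableType d) (R : realType)
    (P : probability T R) (Z : T -> R) (a K t : R) :
  measurable_fun setT Z -> 0 < a -> 0 < K ->
  (forall l, a * `|l| <= 1 ->
    (\int[P]_w (expR (l * Z w))%:E <= (expR (l ^+ 2 * K))%:E)%E) ->
  0 <= t ->
  (P [set w | (t <= `|Z w|)%R] <=
   2%:E * (expR (- Num.min (t ^+ 2 / (4 * K)) (t / (2 * a))))%:E)%E.
Proof.
move=> mZ a0 K0 mgf t0.
set e := Num.min _ _.
have [l l0 [la le]] : exists2 l, 0 <= l & a * `|l| <= 1 /\ l ^+ 2 * K - l * t <= - e.
  have [tK|tK] := leP (t / (2 * K)) a^-1.
    exists (t / (2 * K)); first by rewrite divr_ge0 // mulr_ge0 // ltW.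
    split.
      rewrite ger0_norm; last by rewrite divr_ge0 // mulr_ge0 // ltW.
      by rewrite mulrC -ler_pdivlMr // div1r.
    have -> : (t / (2 * K)) ^+ 2 * K - t / (2 * K) * t = - (t ^+ 2 / (4 * K)).
      by field; rewrite gt_eqF.
    by rewrite lerN2 /e ge_min lexx.
  (* The unconstrained minimizer t / (2 K) is out of range here; from 2 K / a <= t, the endpoint
     gives K / a^2 - t / a <= - t / (2 a). *)
  exists a^-1; first by rewrite invr_ge0 ltW.
  split; first by rewrite ger0_norm ?invr_ge0 ?(ltW a0) // divff // gt_eqF.
  apply: (@le_trans _ _ (- (t / (2 * a)))); last by rewrite lerN2 /e ge_min lexx orbT.
  have : a^-1 * (2 * K) <= t by rewrite -ler_pdivlMr ?mulr_gt0 // ltW.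
  move=> /(ler_wpM2l (_ : 0 <= a^-1)); rewrite invr_ge0 => /(_ (ltW a0)).
  rewrite invfM; lra.
have mexp (c : R) : measurable_fun setT (fun w => expR (c * Z w)).
  by apply: measurableT_comp => //; exact: measurable_funM.
have mA (eps : R) : measurable [set w | (t <= eps * Z w)%R].
  rewrite -[X in measurable X]setTI; apply: measurable_fun_le => //.
  exact: measurable_funM.
(* Markov's inequality for exp(l eps Z); the signs eps = 1 and eps = -1 cover both tails, hence the
   factor 2. *)
have tail (eps : R) : `|eps| = 1 ->
    (P [set w | (t <= eps * Z w)%R] <= (expR (- e))%:E)%E.
  move=> e1.
  have : (\int[P]_w ((expR (l * t))%:E * (\1_[set w | (t <= eps * Z w)%R] w)%:E) <=
      \int[P]_w (expR (l * eps * Z w))%:E)%E.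
    apply: ge0_le_integral => //.
    - by apply: measurable_funeM; apply/measurable_EFinP; exact: measurable_indic.
    - by apply/measurable_EFinP.
    - move=> w _; rewrite -EFinM lee_fin indicE.
      have [|_] := boolP (w \in _); last by rewrite mulr0 expR_ge0.
      by rewrite inE /= mulr1 ler_expR -mulrA => tw; rewrite ler_wpM2l.
  rewrite ge0_integralZl //; last first.
    by apply/measurable_EFinP; exact: measurable_indic.
  rewrite integral_indic // setIT => le1.
  have {le1} := le_trans le1 (mgf _ _); rewrite normrM e1 mulr1 => /(_ la).
  rewrite exprMn -[eps ^+ 2]real_normK ?num_real // e1 expr1n mulr1 muleC.
  rewrite -lee_pdivlMr ?expR_gt0 // => /le_trans; apply.
  by rewrite -expRN -EFinM lee_fin -expRD ler_expR.
have -> : [set w | (t <= `|Z w|)%R] =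
    [set w | (t <= 1 * Z w)%R] `|` [set w | (t <= -1 * Z w)%R].
  by apply/seteqP; split => w /=; rewrite ler_normr mul1r mulN1r => /orP.
apply: (le_trans (measureU2 _ _ _)) => //.
apply: (le_trans (leeD (tail 1 _) (tail (-1) _))); rewrite ?normrN1 ?normr1 //.
by rewrite -EFinM -EFinD lee_fin mulr_natl mulr2n.
Qed.

(* MathComp-Analysis.  In \bar R, 0^-1 = +oo and 0 * +oo = 0, so that the
   quotients below satisfy a / 0 = +oo for a > 0 and 0 / 0 = 0. *)
Theorem theorem1 (R : realType) (d : measure_display) (T : measurableType d)
    (P : probability T R) (n : nat) (sigma : R)
    (X : 'I_n -> {RV P >-> R}) (M : 'M[R]_n)
    (n_ge1 : (1 <= n)%N) (sigma_gt0 : 0 < sigma)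
    (X_indep : mutually_independent X)
    (X_ident : identically_distributed X)
    (X_centered : forall i, ('E_P[X i] = 0)%E)
    (X_subg : forall i, sub_gaussian (X i) (sigma ^+ 2)) :
  let c1 : R := if diagonal_free M then 2 else 20 in
  let c2 : R := if diagonal_free M then 1 else 4 in
  let Q : T -> R := fun w => quadratic_form M (random_vector X w) in
  (forall lambda : R, 0 <= lambda ->
     (lambda%:E < 1 / (3 * c2 * operator_norm M * sigma ^+ 2)%:E)%E ->
     (\int[P]_w expeR (lambda%:E * ((Q w)%:E - 'E_P[Q])) <=
       (expR (c1 * lambda ^+ 2 * sigma ^+ 4 * frobenius_norm M ^+ 2))%:E)%E)
  /\
  (forall t : R, 0 <= t ->
     (P [set w | t%:E <= `| (Q w)%:E - 'E_P[Q] |] <=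
       2%:E * expeR (- mine
         ((t ^+ 2)%:E / (4 * c1 * sigma ^+ 4 * frobenius_norm M ^+ 2)%:E)
         (t%:E / (6 * c2 * sigma ^+ 2 * operator_norm M)%:E)))%E).
Proof.
move=> c1 c2 Q.
have s0 : 0 < sigma ^+ 2 by rewrite exprn_gt0.
have [m EQ] : exists m, ('E_P[Q] = m%:E)%E.
  eexists; exact: (expectation_quadratic_form M s0 X_indep X_subg).
(* The product form of the range includes its endpoint, both signs of [l], and a vanishing operator
   norm without division. *)
have mgf l : 3 * c2 * operator_norm M * sigma ^+ 2 * `|l| <= 1 ->
    (\int[P]_w (expR (l * (Q w - m)))%:E <=
     (expR (l ^+ 2 * (c1 * sigma ^+ 4 * frobenius_norm M ^+ 2)))%:E)%E.
  have := @quadratic_form_mgf_le _ _ _ P n X _ M s0 X_indep X_subg l.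
  have := expectation_quadratic_form M s0 X_indep X_subg.
  by rewrite EQ => -[<-]; rewrite -exprM.
have c1_gt0 : 0 < c1 by rewrite /c1; case: ifP.
have c2_gt0 : 0 < c2 by rewrite /c2; case: ifP.
set N := operator_norm M in mgf *.
have N0 : 0 <= N := operator_norm_ge0 M.
pose a := 3 * c2 * N * sigma ^+ 2.
split.
  move=> l l0 lN; rewrite EQ.
  have {}lN : a * `|l| <= 1.
    rewrite ger0_norm //.
    have [a0|a_neq0] := eqVneq a 0; first by rewrite a0 mul0r.
    have a_gt0 : 0 < a.
      by rewrite lt_def a_neq0 /a !mulr_ge0 // ltW.
    move: lN; rewrite -/a inver (negbTE a_neq0) mul1e lte_fin => /ltW.
    by rewrite -[_^-1]mul1r ler_pdivlMr // mulrC.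
  under eq_integral do rewrite -EFinB -EFinM /=.
  by apply: (le_trans (mgf l lN)); rewrite lee_fin ler_expR; lra.
move=> t t0; rewrite EQ.
have mZ : measurable_fun setT (fun w => Q w - m).
  by apply: measurable_funB => //; exact: measurable_quadratic_form.
have mA : measurable [set w | t <= `|Q w - m|].
  rewrite -[X in measurable X]setTI; apply: measurable_fun_le => //.
  exact: measurableT_comp.
(* For [t = 0] both quotients are 0 even over a null denominator, so the right-hand side is 2. *)
have [t_eq0|t_neq0] := eqVneq t 0.
  apply: (@le_trans _ _ 1%E); first exact: probability_le1.
  by rewrite t_eq0 expr0n !mul0e /mine ltxx oppe0 expeR0 mule1 lee_fin ler1n.
have t_gt0 : 0 < t by rewrite lt_def t_neq0.
(* For [M = 0] and [t > 0] the event is empty. Otherwise both denominators are positive and the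
   quotients are real. *)
have [M0|M_neq0] := eqVneq M 0.
  have Q0 : Q = cst 0.
    by apply/funext => w; rewrite /Q M0 /quadratic_form mulmx0 mul0mx mxE.
  have m0 : m = 0 by have := EQ; rewrite Q0 expectation_cst => -[].
  rewrite (_ : [set w | _] = set0) ?measure0 ?mule_ge0 ?expeR_ge0 //.
  apply/seteqP; split => // w; rewrite /= Q0 m0 lee_fin subrr normr0.
  by rewrite leNgt t_gt0.
have N_gt0 : 0 < N.
  by rewrite lt_def N0 andbT; apply: contra_neq M_neq0; exact: operator_norm_eq0.
have F_gt0 : 0 < frobenius_norm M ^+ 2.
  have row0 i : 0 <= \sum_j M i j ^+ 2 by apply: sumr_ge0 => j _; exact: sqr_ge0.
  rewrite sqr_frobenius_norm lt_def sumr_ge0 // andbT.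
  apply: contra_neq M_neq0 => F0; apply/matrixP => i j; rewrite mxE.
  have Mi0 : \sum_j M i j ^+ 2 = 0 by apply: (psumr_eq0P _ F0).
  apply/eqP; rewrite -sqrf_eq0; apply/eqP.
  by apply: (psumr_eq0P _ Mi0) => // k _; exact: sqr_ge0.
pose K := c1 * sigma ^+ 4 * frobenius_norm M ^+ 2.
have K_gt0 : 0 < K by rewrite mulr_gt0 // mulr_gt0 // exprn_gt0.
have a_gt0 : 0 < a by rewrite mulr_gt0 // !mulr_gt0.
have := two_sided_chernoff mZ a_gt0 K_gt0 mgf t0.
have -> : 4 * c1 * sigma ^+ 4 * frobenius_norm M ^+ 2 = 4 * K by rewrite /K !mulrA.
have -> : 6 * c2 * sigma ^+ 2 * N = 2 * a by rewrite /a; ring.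
have K4 : 0 < 4 * K by rewrite mulr_gt0.
have a2 : 0 < 2 * a by rewrite mulr_gt0.
by rewrite !inver (gt_eqF K4) (gt_eqF a2) -!EFinM -EFin_min.
Qed.
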